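(* Let $\mathcal{S}$ be a $q$-semi-intersecting biset-family on $V$, $|V|=n$, and let $G=(V,E)$ be a directed graph with nonnegative edge costs $c$. Assuming the cores of $\mathcal{S}^J$ can be computed in polynomial time for any edge set $J$, there is a polynomial-time algorithm that computes an edge set $J\subseteq E$ such that $\nu(\mathcal{S}^J)\le\lfloor n/(q+1)\rfloor$ and $c(J)\le\tau(\mathcal{S})$.
   Context: A biset on $V$ is a pair $\hat S=(S,S^+)$ with $S\subseteq S^+\subseteq V$, proper if $S\ne\emptyset$ and $V\setminus S^+\neq\emptyset$; all biset-families consist of proper bisets. $\hat X,\hat Y$ intersect if $X\cap Y\ne\emptyset$. $\hat X\cap\hat Y=(X\cap Y,X^+\cap Y^+)$, $\hat X\cup\hat Y=(X\cup Y,X^+\cup Y^+)$. A biset-family $\mathcal{S}$ is intersection-closed if $\hat X\cap\hat Y\in\mathcal{S}$ for all intersecting $\hat X,\hat Y\in\mathcal{S}$; an intersection-closed $\mathcal{S}$ is $q$-semi-intersecting if $|S|\le q$ for all $\hat S\in\mathcal{S}$ and $\hat X\cup\hat Y\in\mathcal{S}$ for all intersecting $\hat X,\hat Y\in\mathcal{S}$ with $|X\cup Y|\le q$. Biset containment: $\hat X\subseteq\hat Y$ if $X\subset Y$, or $X=Y$ and $X^+\subseteq Y^+$. A core of $\mathcal{S}$ is a member containing no other member of $\mathcal{S}$; $\nu(\mathcal{S})$ is the number of cores. A directed edge $uv$ covers $\hat S$ if $u\in S$, $v\in V\setminus S^+$; $\delta_J(\hat S)$ is the set of edges in $J$ covering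 $\hat S$; $\mathcal{S}^J$ is the family of members of $\mathcal{S}$ not covered by any edge of $J$. $\tau(\mathcal{S})=\min\{\sum_{e\in E}c_ex_e:\sum_{e\in\delta_E(\hat S)}x_e\ge1\ \forall\hat S\in\mathcal{S},\ x\ge0\}$. *)

(* Defs.v *)
From HB Require Import structures.
From mathcomp Require Import all_boot all_order all_algebra.
From mathcomp Require Import reals.

Set Implicit Arguments.
Unset Strict Implicit.
Unset Printing Implicit Defensive.

Import Order.TTheory GRing.Theory Num.Theory.

(** * Biset families *)

Section Bisets.
Variable V : finType.

(* The pair (S, S^+); the inclusion of S in S^+ is part of [proper_biset]. *)
Definition biset := ({set V} * {set V})%type.

Definition proper_biset (X : biset) : bool :=
  [&& X.1 \subset X.2, X.1 != set0 & ~: X.2 != set0].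

Definition intersecting (X Y : biset) : bool := X.1 :&: Y.1 != set0.

Definition bisetI (X Y : biset) : biset := (X.1 :&: Y.1, X.2 :&: Y.2).
Definition bisetU (X Y : biset) : biset := (X.1 :|: Y.1, X.2 :|: Y.2).

(* Containment does not compare the outer parts when the inner parts differ. *)
Definition biset_sub (X Y : biset) : bool :=
  (X.1 \proper Y.1) || (X.1 == Y.1) && (X.2 \subset Y.2).

Definition biset_family (F : {set biset}) : Prop :=
  forall X, X \in F -> proper_biset X.

Definition intersection_closed (F : {set biset}) : Prop :=
  forall X Y, X \in F -> Y \in F -> intersecting X Y -> bisetI X Y \in F.

Definition semi_intersecting (q : nat) (F : {set biset}) : Prop :=
  [/\ biset_family F,
      intersection_closed F,
      forall X, X \in F -> #|X.1| <= q
    & forall X Y, X \in F -> Y \in F -> intersecting X Y ->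
        #|X.1 :|: Y.1| <= q -> bisetU X Y \in F].

Definition cores (F : {set biset}) : {set biset} :=
  [set C in F | [forall Y in F, biset_sub Y C ==> (Y == C)]].

Definition nu (F : {set biset}) : nat := #|cores F|.

Definition covers (e : V * V) (X : biset) : bool :=
  (e.1 \in X.1) && (e.2 \notin X.2).

Definition delta (J : {set V * V}) (X : biset) : {set V * V} :=
  [set e in J | covers e X].

Definition residual (F : {set biset}) (J : {set V * V}) : {set biset} :=
  [set X in F | delta J X == set0].

Section CoveringLP.
Variables (R : realType) (F : {set biset}) (E : {set V * V}) (c : V * V -> rat).
Local Open Scope ring_scope.

Definition lp_feasible (x : V * V -> R) : Prop :=
  (forall e, e \in E -> 0 <= x e) /\
  (forall X, X \in F -> 1 <= \sum_(e in delta E X) x e).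

Definition lp_value (x : V * V -> R) : R := \sum_(e in E) ratr (c e) * x e.

(* [t] is the minimum of the covering LP; there is none if the LP is
   infeasible, that is, if some member of [F] is covered by no edge of [E]. *)
Definition is_tau (t : R) : Prop :=
  (exists2 x, lp_feasible x & lp_value x = t) /\
  (forall x, lp_feasible x -> t <= lp_value x).

End CoveringLP.
End Bisets.

(** * A machine model *)

(* A WHILE language over binary trees, as in N. D. Jones, "Computability and
   Complexity", whose atoms are rational numbers.  Trees are built and
   inspected by unit-cost pointer operations; arithmetic and comparison are
   charged the bit length of their operands.  Polynomial time in this model is
   the usual polynomial time on Turing machines. *)

Inductive tree : Type :=
  | TNil
  | TNum of rat
  | TCons of tree & tree.

Definition bits (r : rat) : nat :=
  (trunc_log 2 `|numq r|%N).+1 + (trunc_log 2 `|denq r|%N).+1.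

Fixpoint tsize (v : tree) : nat :=
  match v with
  | TNil => 1
  | TNum r => bits r
  | TCons a b => (tsize a + tsize b).+1
  end.

(* [TNil] is the only false value. *)
Definition truth (v : tree) : bool := if v is TNil then false else true.
Definition of_bool (b : bool) : tree := if b then TCons TNil TNil else TNil.

Definition hd (v : tree) : tree := if v is TCons a _ then a else TNil.
Definition tl (v : tree) : tree := if v is TCons _ b then b else TNil.
Definition is_cons (v : tree) : tree := of_bool (if v is TCons _ _ then true else false).

Inductive binop : Type := Add | Sub | Mul | Div | Leq.

Definition eval_binop (o : binop) (a b : tree) : tree :=
  match a, b with
  | TNum r, TNum s =>
      match o with
      | Add => TNum (r + s)%R
      | Sub => TNum (r - s)%R
      | Mul => TNum (r * s)%R
      | Div => TNum (r / s)%R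
      | Leq => of_bool (r <= s)%R
      end
  | _, _ => TNil
  end.

Inductive expr : Type :=
  | EVar of nat
  | ENil
  | ENum of rat
  | ECons of expr & expr
  | EHead of expr
  | ETail of expr
  | EIsCons of expr
  | EBin of binop & expr & expr.

Definition store := nat -> tree.
Definition upd (s : store) (x : nat) (v : tree) : store :=
  fun y => if y == x then v else s y.

Fixpoint eval (s : store) (e : expr) : tree :=
  match e with
  | EVar x => s x
  | ENil => TNil
  | ENum r => TNum r
  | ECons e1 e2 => TCons (eval s e1) (eval s e2)
  | EHead e1 => hd (eval s e1)
  | ETail e1 => tl (eval s e1)
  | EIsCons e1 => is_cons (eval s e1)
  | EBin o e1 e2 => eval_binop o (eval s e1) (eval s e2)
  end.

Fixpoint eval_time (s : store) (e : expr) : nat :=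
  match e with
  | EVar _ | ENil | ENum _ => 1
  | ECons e1 e2 => (eval_time s e1 + eval_time s e2).+1
  | EHead e1 | ETail e1 | EIsCons e1 => (eval_time s e1).+1
  | EBin _ e1 e2 =>
      (eval_time s e1 + eval_time s e2
       + (tsize (eval s e1) + tsize (eval s e2))).+1
  end.

(* [PCall x p e] runs [p] as a procedure with its own store on the value of [e]
   and assigns the result to [x]. *)
Inductive prog : Type :=
  | PSkip
  | PAssign of nat & expr
  | PSeq of prog & prog
  | PIf of expr & prog & prog
  | PWhile of expr & prog
  | PCall of nat & prog & expr.

(* A program reads its input from, and leaves its output in, variable 0. *)
Definition init_store (v : tree) : store := upd (fun=> TNil) 0 v.

(* [exec p s s' t]: started in [s], [p] terminates in [s'] after time [t]. *)
Inductive exec : prog -> store -> store -> nat -> Prop :=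
  | exec_Skip s : exec PSkip s s 1
  | exec_Assign s x e :
      exec (PAssign x e) s (upd s x (eval s e)) (eval_time s e).+1
  | exec_Seq p1 p2 s s1 s2 t1 t2 :
      exec p1 s s1 t1 -> exec p2 s1 s2 t2 ->
      exec (PSeq p1 p2) s s2 (t1 + t2)
  | exec_If e p1 p2 s s1 t :
      exec (if truth (eval s e) then p1 else p2) s s1 t ->
      exec (PIf e p1 p2) s s1 (eval_time s e + t).+1
  | exec_While_end e p s :
      ~~ truth (eval s e) -> exec (PWhile e p) s s (eval_time s e).+1
  | exec_While_loop e p s s1 s2 t1 t2 :
      truth (eval s e) -> exec p s s1 t1 -> exec (PWhile e p) s1 s2 t2 ->
      exec (PWhile e p) s s2 (eval_time s e + t1 + t2).+1
  | exec_Call x p e s s1 t :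
      exec p (init_store (eval s e)) s1 t ->
      exec (PCall x p e) s (upd s x (s1 0)) (eval_time s e + t).+1.

(* On input [v], [p] halts within the time bound with an output satisfying
   [good]. *)
Definition computes_within
    (p : prog) (b : {poly nat}) (v : tree) (good : tree -> Prop) : Prop :=
  exists s t, [/\ exec p (init_store v) s t, t <= b.[tsize v]%R & good (s 0)].

(** * Encodings *)

Section Codes.
Variables (T : finType) (code : T -> tree -> Prop).

Fixpoint seq_code (l : seq T) (v : tree) : Prop :=
  match l, v with
  | [::], TNil => True
  | a :: l', TCons h t => code a h /\ seq_code l' t
  | _, _ => False
  end.

(* A finite set is presented by listing its elements without repetition, in
   any order. *)
Definition set_code (A : {set T}) (v : tree) : Prop :=
  exists l : seq T, [/\ uniq l, l =i A & seq_code l v].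

End Codes.

Definition vertex_code (n : nat) (i : 'I_n) (v : tree) : Prop :=
  v = TNum (i%:R)%R.

Definition edge_code (n : nat) (e : 'I_n * 'I_n) (v : tree) : Prop :=
  exists a b, [/\ vertex_code e.1 a, vertex_code e.2 b & v = TCons a b].

Definition weighted_edge_code
    (n : nat) (c : 'I_n * 'I_n -> rat) (e : 'I_n * 'I_n) (v : tree) : Prop :=
  exists2 a, edge_code e a & v = TCons a (TNum (c e)).

Definition biset_code (n : nat) (X : biset 'I_n) (v : tree) : Prop :=
  exists a b, [/\ set_code (@vertex_code n) X.1 a,
                  set_code (@vertex_code n) X.2 b & v = TCons a b].

(* The vertex set is 'I_n.  The family may have exponentially many members and
   is not part of the encoded input; [inst_data] is whatever additional data
   (possibly none) serves to specify it to the algorithm computing cores.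
   Costs are rational, being part of a finite input. *)
Record instance : Type := Instance {
  inst_n : nat;
  inst_q : nat;
  inst_family : {set biset 'I_inst_n};
  inst_edges : {set 'I_inst_n * 'I_inst_n};
  inst_cost : 'I_inst_n * 'I_inst_n -> rat;
  inst_data : tree
}.

Arguments inst_cost : clear implicits.

(* Listing the vertices makes the input size at least [inst_n i]. *)
Definition instance_code (i : instance) (v : tree) : Prop :=
  exists vs es,
    [/\ set_code (@vertex_code (inst_n i)) [set: 'I_(inst_n i)] vs,
        set_code (weighted_edge_code (inst_cost i)) (inst_edges i) es
      & v = TCons vs (TCons (TNum ((inst_q i)%:R)%R)
                          (TCons es (inst_data i)))].

(* Main.v *)
Require Import Defs.
From HB Require Import structures.
From mathcomp Require Import all_boot all_order all_algebra.
From mathcomp Require Import reals.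
From mathcomp Require Import zify.

(* Primal-dual algorithm with a reverse selection step.  While some member of
   [F] is uncovered, take a core [C], raise its dual variable until an edge [e]
   covering [C] becomes tight, and buy [e].  Then scan the purchases [(C, e)]
   from the last to the first, keeping [e] when no kept edge covers [C].

   The chosen cores are laminar, a later one containing the earlier ones it
   meets, so the kept edges cover each of them exactly once; as they are tight,
   their cost is at most the value of the dual solution, hence at most tau.

   Let [G] be the family left uncovered by the kept edges.  For [X] in [G] there
   is a kept [(C, e)] with the tail of [e] in [X] and [C] not contained in [X].
   If [X] and [C] have a union of size at most [q], this union is in [G]; hence
   no member of [G] is contained in the core of a kept edge, and every core of
   [G] grows to some [X] in [G] meeting no other core, with [X] and [C] having
   together more than [q] elements.  These blocks are pairwise disjoint, so there
   are at most [n / (q + 1)] of them.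

   For the running time, reduced costs stay between 0 and the original costs and
   their denominators divide the product of the denominators of the costs, so
   that they keep polynomial bit length. *)

Set Implicit Arguments.
Unset Strict Implicit.
Unset Printing Implicit Defensive.

Import Order.TTheory GRing.Theory Num.Theory.

(* The identifier is shadowed by [tuple.tsize]. *)
Local Notation tsize := Defs.tsize.

(** * Uncovered cores after the reverse selection *)

Section Families.
Variables (V : finType) (q : nat).
Implicit Types (F : {set biset V}) (J : {set V * V}) (X Y C : biset V) (e : V * V).

(** Unlike [biset_sub], this always compares the outer parts: an edge that covers the larger biset
    and has its tail in the smaller one then covers the smaller one too. *)
Definition bsubset X Y := (X.1 \subset Y.1) && (X.2 \subset Y.2).

Lemma intersectingP X Y : reflect (exists2 x, x \in X.1 & x \in Y.1) (intersecting X Y).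
Proof.
apply: (iffP (set0Pn _)) => [[x /setIP[]]|[x xX xY]]; first by exists x.
by exists x; apply/setIP.
Qed.

Lemma residualP F J X :
  reflect (X \in F /\ forall e, e \in J -> ~~ covers e X) (X \in residual F J).
Proof.
rewrite inE; apply: (iffP andP) => -[XF H]; split=> //.
  move=> e eJ; apply/negP => eX; move/eqP/setP/(_ e): H.
  by rewrite !inE eJ eX.
by apply/eqP/setP => e; rewrite !inE; apply/andP => -[eJ]; apply/negP/H.
Qed.

Lemma covers_bisetI e X Y :
  covers e (bisetI X Y) -> covers e X || covers e Y.
Proof. by rewrite /covers !inE => /andP[/andP[-> ->]]; rewrite negb_and. Qed.

Lemma covers_bisetU e X Y :
  covers e (bisetU X Y) -> covers e X || covers e Y.
Proof.
by rewrite /covers !inE negb_or => /andP[/orP[]-> /andP[-> ->]]; rewrite ?orbT.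
Qed.

Lemma residual_semi_intersecting F J :
  semi_intersecting q F -> semi_intersecting q (residual F J).
Proof.
case=> Fp FI Fq FU; split.
- by move=> X /residualP[/Fp].
- move=> X Y /residualP[XF HX] /residualP[YF HY] XY; apply/residualP.
  split=> [|e eJ]; first exact: FI.
  apply/negP => /covers_bisetI; apply/negP.
  by rewrite negb_or HX ?HY.
- by move=> X /residualP[/Fq].
- move=> X Y /residualP[XF HX] /residualP[YF HY] XY XYq; apply/residualP.
  split=> [|e eJ]; first exact: FU.
  apply/negP => /covers_bisetU; apply/negP.
  by rewrite negb_or HX ?HY.
Qed.

(** The intersection is a member contained in [C], so minimality makes it equal to [C]. *)
Lemma core_sub F C X : intersection_closed F ->
  C \in cores F -> X \in F -> intersecting C X -> bsubset C X.
Proof.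
move=> FI; rewrite inE => /andP[CF /forall_inP Cmin] XF CX.
have /implyP := Cmin _ (FI _ _ CF XF CX).
have -> : biset_sub (bisetI C X) C.
  rewrite /biset_sub /= subsetIl andbT properEneq subsetIl andbT.
  by case: eqP.
move=> /(_ isT) /eqP E; rewrite /bsubset -{1 2}E /=.
by rewrite !subsetIr.
Qed.

Lemma core_exists F X : X \in F -> exists2 C, C \in cores F & C.1 \subset X.1.
Proof.
(* The weight [#|V|.+1] makes the measure lexicographic: the outer part may grow when the inner part
   shrinks. *)
have [k] := ubnP (#|X.1| * #|V|.+1 + #|X.2|); elim: k X => // k IH X lek XF.
have [XC|] := boolP (X \in cores F); first by exists X.
rewrite inE XF => /forall_inPn[Y YF]; rewrite negb_imply => /andP[YX neYX].
have Y1X : Y.1 \subset X.1.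
  by case/orP: YX => [/proper_sub//|/andP[/eqP->]].
have [|//|C CF CY] := IH Y; last by exists C => //; apply: subset_trans Y1X.
have cY2 := max_card Y.2.
case/orP: YX => [/proper_card lt1|/andP[/eqP Y1 Y2]].
  have := leq_mul lt1 (leqnn #|V|.+1); move: cY2 lek; rewrite mulSn.
  by move: (_ * _) (_ * _) #|Y.2| #|X.2| => a b c d; lia.
have : #|Y.2| < #|X.2|.
  apply: proper_card; rewrite properEneq Y2 andbT.
  by apply: contraNneq neYX => E2; rewrite -pair_eqE /= Y1 E2 !eqxx.
by move: lek; rewrite Y1; move: (_ * _) #|Y.2| #|X.2| => a b c; lia.
Qed.

Lemma cores_eq0 F : cores F = set0 -> F = set0.
Proof.
move=> F0; apply/eqP/set0Pn => -[X /core_exists[C]].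
by rewrite F0 inE.
Qed.

Lemma cores_disjoint F C D : intersection_closed F ->
  C \in cores F -> D \in cores F -> intersecting C D -> C = D.
Proof.
move=> FI CF DF CD.
have DC : intersecting D C by rewrite /intersecting setIC.
have inF E : E \in cores F -> E \in F by rewrite inE => /andP[].
have /andP[s1 s2] := core_sub FI CF (inF _ DF) CD.
have /andP[s3 s4] := core_sub FI DF (inF _ CF) DC.
apply/eqP; rewrite -pair_eqE /= !eqEsubset.
by rewrite s1 s2 s3 s4.
Qed.

(** Decreases whenever a union enlarges a biset; it drives the growing arguments below. *)
Definition missing X := #|~: X.1| + #|~: X.2|.

Lemma bisetU_measure X Y : ~~ bsubset Y X -> missing (bisetU X Y) < missing X.
Proof.
have le (A B : {set V}) : #|~: (B :|: A)| <= #|~: B|.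
  by apply: subset_leq_card; rewrite setCS subsetUl.
have lt (A B : {set V}) : ~~ (A \subset B) -> #|~: (B :|: A)| < #|~: B|.
  move=> AB; apply: proper_card; rewrite properC properE subsetUl /=.
  by rewrite subUset subxx.
rewrite /bsubset negb_and /missing -addSn => /orP[/lt|/lt] H.
  exact: leq_add H (le _ _).
rewrite addSn -addnS; exact: leq_add (le _ _) H.
Qed.

End Families.

(* Index 0 is the last core chosen: the core [C i] is chosen when exactly the
   edges [e j] with [i < j < m] have been bought. *)
Section ReverseSelection.
Variables (V : finType) (q : nat) (F : {set biset V}).
Hypothesis Fsemi : semi_intersecting q F.
Variables (m : nat) (C : nat -> biset V) (e : nat -> V * V).
Hypothesis C_core : forall i, i < m ->
  C i \in cores (residual F [set x | [exists j : 'I_m, (i < j) && (x == e j)]]).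
Hypothesis e_covers : forall i, i < m -> covers (e i) (C i).

(** [select p] scans the indices below [p] upwards, that is, the purchases from the last one
    backwards. *)
Fixpoint select (p : nat) : seq (V * V) :=
  if p is p'.+1 then
    let A := select p' in if has (fun x => covers x (C p')) A then A else e p' :: A
  else [::].

Definition kept (i : nat) := ~~ has (fun x => covers x (C i)) (select i).

Definition selected : {set V * V} := [set x in select m].

Lemma mem_select p x :
  reflect (exists i, [/\ i < p, kept i & x = e i]) (x \in select p).
Proof.
elim: p => [|p IH] /=; first by apply: ReflectF => -[i []].
have [kp|kp] := ifP.
  apply: (iffP IH) => -[i [ip ki xi]]; exists i; split=> //; first by lia.
  have : i != p by apply: contraTneq ki => ->; rewrite /kept kp.
  by lia.
rewrite inE; apply: (iffP orP) => [[/eqP->|/IH[i [ip ki xi]]]|].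
- by exists p; split=> //; rewrite /kept kp.
- by exists i; split=> //; lia.
- move=> [i [ip ki xi]]; have [ip'|] := eqVneq i p; first by left; rewrite xi ip'.
  by move=> ne; right; apply/IH; exists i; split=> //; lia.
Qed.

Lemma mem_selected x :
  reflect (exists i, [/\ i < m, kept i & x = e i]) (x \in selected).
Proof. by rewrite inE; apply: mem_select. Qed.

Lemma kept_uncovered k l : k < l -> kept k -> kept l -> ~~ covers (e k) (C l).
Proof.
move=> kl kk /hasPn; apply; apply/mem_select; by exists k.
Qed.

Lemma selected_covers i : i < m ->
  exists k, [/\ k <= i, kept k & covers (e k) (C i)].
Proof.
move=> im; have [ki|] := boolP (kept i); first by exists i; split=> //; apply: e_covers.
rewrite negbK => /hasP[x /mem_select[k [ki kk ->]] ck].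
by exists k; split=> //; lia.
Qed.

Lemma C_residual i : i < m ->
  C i \in F /\ forall j, i < j < m -> ~~ covers (e j) (C i).
Proof.
move=> im; have := C_core im; rewrite inE => /andP[/residualP[CF H] _].
split=> // j /andP[ij jm]; apply: H; rewrite inE; apply/existsP.
by exists (Ordinal jm); rewrite ij eqxx.
Qed.

Lemma C_uncovered i j : i < j < m -> ~~ covers (e j) (C i).
Proof. by move=> /[dup] ijm /andP[ij jm]; apply: (C_residual _).2 ijm; lia. Qed.

(** When [C i] was chosen, [X] was still uncovered by the edges bought so far, so [core_sub] applies
    in that residual family. *)
Lemma C_sub i X : i < m -> X \in F ->
  (forall j, i < j < m -> ~~ covers (e j) X) -> intersecting (C i) X ->
  bsubset (C i) X.
Proof.
move=> im XF HX; have := C_core im; set G := residual _ _ => CG.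
apply: (core_sub _ CG); first by case: (residual_semi_intersecting
    [set x | [exists j : 'I_m, (i < j) && (x == e j)]] Fsemi).
apply/residualP; split=> // x; rewrite inE => /existsP[j /andP[ij /eqP->]].
by apply: HX; rewrite ij /=.
Qed.

(** [C i] is chosen no earlier than [C j], hence was still uncovered when [C j] was a core. This is
    the laminarity of the chosen cores. *)
Lemma C_nested i j : i <= j < m -> intersecting (C j) (C i) -> bsubset (C j) (C i).
Proof.
move=> /andP[ij jm]; apply: C_sub => //; first by apply: (C_residual _).1; lia.
by move=> l /andP[jl lm]; apply: C_uncovered; lia.
Qed.

Lemma C_nested_tail i j u : i <= j < m -> u \in (C j).1 -> u \in (C i).1 ->
  bsubset (C j) (C i).
Proof. by move=> ijm uj ui; apply: C_nested => //; apply/intersectingP; exists u. Qed.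

(** For [k < l], the tails nest [C i] in [C l] and [C l] in [C k]. Then [e k] has its tail in [C l]
    and its head outside the outer part of [C k], so it covers [C l], which would have prevented
    keeping [e l]. *)
Lemma selected_once i k l : i < m -> k < m -> l < m -> kept k -> kept l ->
  covers (e k) (C i) -> covers (e l) (C i) -> k = l.
Proof.
wlog lt_kl : k l / k < l.
  move=> H im km lm kk kl ck cl.
  by have [lt|lt|//] := ltngtP k l; [|symmetry]; apply: H.
move=> im km lm kk kl ck cl.
have li : l <= i by rewrite leqNgt; apply: contraL cl => il; apply: C_uncovered; rewrite il.
have /andP[tki _] := ck; have /andP[tli _] := cl.
have /andP[tk _] := e_covers km; have /andP[tl _] := e_covers lm.
have /andP[il1 il2] : bsubset (C i) (C l) by apply: C_nested_tail tli tl; rewrite li.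
have /andP[ik1 _] : bsubset (C i) (C k) 
  by apply: C_nested_tail tki tk; rewrite im (leq_trans (ltnW lt_kl)).
have /andP[lk1 lk2] : bsubset (C l) (C k).
  by apply: C_nested_tail tl (subsetP ik1 _ tli); rewrite ltnW.
have := kept_uncovered lt_kl kk kl; rewrite /covers.
rewrite (subsetP il1) //=.
by have /andP[_] := e_covers km; move=> /(contra (subsetP lk2 _)) ->.
Qed.

Let G := residual F selected.

Hypothesis F_covered : forall X, X \in F -> exists2 i, i < m & covers (e i) X.

Lemma G_uncovered X k : X \in G -> k < m -> kept k -> ~~ covers (e k) X.
Proof. by move=> /residualP[_ H] km kk; apply: H; apply/mem_selected; exists k. Qed.

Lemma grow X : X \in G -> exists k,
  [/\ k < m, kept k, (e k).1 \in X.1, (e k).1 \in (C k).1 & ~~ bsubset (C k) X].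
Proof.
move=> XG; have /residualP[XF _] := XG.
have exP : exists i, (i < m) && covers (e i) X.
  by have [i im ci] := F_covered XF; exists i; rewrite im.
have ubP i : (i < m) && covers (e i) X -> i <= m by move=> /andP[/ltnW].
(* The largest index gives the earliest bought edge covering [X]; until then [X] was uncovered, so
   the core [C i] lies inside [X]. *)
case: (ex_maxnP exP ubP) => i /andP[im ciX] imax.
have /andP[eiX eiX2] := ciX.
have /andP[eiC eiC2] := e_covers im.
have /andP[iX1 iX2] : bsubset (C i) X.
  apply: C_sub => //; last by apply/intersectingP; exists (e i).1.
  move=> j /andP[ij jm]; apply/negP => cj.
  by have := imax j; rewrite jm cj leqNgt ij => /(_ isT).
have [k [ki kk cki]] := selected_covers im.
have km := leq_ltn_trans ki im.
have /andP[eki eki2] := cki.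
have /andP[ekC ekC2] := e_covers km.
exists k; split=> //; first exact: (subsetP iX1).
(* If [C k] lay inside [X], then [e i], with its tail in [C k] by nesting and its head outside [X],
   would cover [C k], although it was bought before [C k] was chosen. *)
apply/negP => /andP[kX1 kX2].
have nki : k != i.
  by apply: contraNneq (G_uncovered XG km kk) => ->.
have /andP[ik1 ik2] : bsubset (C i) (C k).
  by apply: (C_nested_tail (u := (e k).1)); rewrite ?ki.
have kim : k < i < m by rewrite ltn_neqAle nki ki.
have /negP := C_uncovered kim; apply.
by rewrite /covers (subsetP ik1) //=; apply: contra eiX2; apply: (subsetP kX2).
Qed.

(** A kept edge covering the union covers [C k] and not [X], so by uniqueness it is [e k]; but with
    its tail in [X] it would cover [X] as well. *)
Lemma G_bisetU X k : X \in G -> k < m -> kept k -> (e k).1 \in X.1 ->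
  #|X.1 :|: (C k).1| <= q -> bisetU X (C k) \in G.
Proof.
move=> XG km kk ekX leq; have /residualP[XF _] := XG.
have [_ _ _ FU] := Fsemi.
have /andP[ekC ekC2] := e_covers km.
apply/residualP; split.
  apply: FU => //; first exact: (C_residual km).1.
  by apply/intersectingP; exists (e k).1.
move=> x /mem_selected[l [lm kl ->]]; apply/negP => cl.
have := covers_bisetU cl; rewrite (negPf (G_uncovered XG lm kl)) /= => clk.
have E := selected_once km km lm kk kl (e_covers km) clk; subst l.
have := G_uncovered XG km kk; rewrite /covers ekX /=.
by case/andP: cl => _; rewrite inE negb_or => /andP[->].
Qed.

(** As for the union, only [e k] could cover the intersection, and its tail is outside [X]. *)
Lemma G_bisetI X k : X \in G -> k < m -> kept k -> (e k).1 \notin X.1 ->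
  intersecting X (C k) -> bisetI X (C k) \in G.
Proof.
move=> XG km kk ekX XC; have /residualP[XF _] := XG.
have [_ FI _ _] := Fsemi.
apply/residualP; split; first by apply: FI => //; exact: (C_residual km).1.
move=> x /mem_selected[l [lm kl ->]]; apply/negP => cl.
have := covers_bisetI cl; rewrite (negPf (G_uncovered XG lm kl)) /= => clk.
have E := selected_once km km lm kk kl (e_covers km) clk; subst l.
by case/andP: cl; rewrite inE (negPf ekX).
Qed.

(** By [grow], such an [X] can be enlarged by some [C k'] that is still inside [C k], where the size
    bound [q] comes for free; this cannot go on forever. *)
Lemma G_bsubsetF X k : X \in G -> k < m -> kept k -> ~~ bsubset X (C k).
Proof.
have [p] := ubnP (missing X); elim: p X => // p IH X lep XG km kk.
apply/negP => /andP[Xk1 Xk2].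
have [k' [k'm kk' ekX ekC nsub]] := grow XG.
have ekk := subsetP Xk1 _ ekX.
have /andP[_ ekC2] := e_covers k'm.
(* If [k' <= k], then [C k] is nested in [C k'], so [e k'] covers [C k]; uniqueness gives [k' = k],
   and this edge would cover [X]. *)
have lt_kk' : k < k'.
  rewrite ltnNge; apply/negP => le_k'k.
  have /andP[kk1 kk2] : bsubset (C k) (C k').
    by apply: (C_nested_tail (u := (e k').1)); rewrite ?le_k'k.
  have ck : covers (e k') (C k).
    by rewrite /covers ekk; apply: contra ekC2; apply: (subsetP kk2).
  have E := selected_once km k'm km kk' kk ck (e_covers km); subst k'.
  have := G_uncovered XG km kk; rewrite /covers ekX /=.
  by rewrite (contra (subsetP Xk2 _) ekC2).
have /andP[kk1 kk2] : bsubset (C k') (C k).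
  by apply: (C_nested_tail (u := (e k').1)); rewrite ?(ltnW lt_kk').
have UG : bisetU X (C k') \in G.
  apply: G_bisetU => //; apply: (@leq_trans #|(C k).1|).
    by apply: subset_leq_card; rewrite subUset Xk1.
  by have [_ _ + _] := Fsemi; apply; exact: (C_residual km).1.
have [] := negP (IH _ _ UG km kk); last by rewrite /bsubset /= !subUset Xk1 Xk2 kk1.
exact: leq_trans (bisetU_measure nsub) lep.
Qed.

(** Starting from [D], the sets [C k] given by [grow] are added as long as the union has at most [q]
    elements. *)
Lemma core_block D : D \in cores G -> exists X k,
  [/\ X \in G, k < m, kept k, (e k).1 \in X.1 &
  [/\ forall D', D' \in cores G -> D' != D -> ~~ intersecting D' X
    & q < #|X.1 :|: (C k).1|]].
Proof.
move=> DG; have [_ GI _ _] : semi_intersecting q G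
  by apply: residual_semi_intersecting.
have inG E : E \in cores G -> E \in G by rewrite inE => /andP[].
suff H X : X \in G -> (forall D', D' \in cores G -> D' != D -> ~~ intersecting D' X) ->
  exists X k, [/\ X \in G, k < m, kept k, (e k).1 \in X.1 &
    [/\ forall D', D' \in cores G -> D' != D -> ~~ intersecting D' X
      & q < #|X.1 :|: (C k).1|]].
  apply: (H D); first exact: inG.
  by move=> D' D'G; apply: contraNN => /(cores_disjoint GI D'G DG) ->.
have [p] := ubnP (missing X); elim: p X => // p IH X lep XG HX.
have [k [km kk ekX ekC nsub]] := grow XG.
have [big|small] := ltnP q #|X.1 :|: (C k).1|; first by exists X, k; split.
have UG := G_bisetU XG km kk ekX small.
apply: (IH (bisetU X (C k))) => //.
  exact: leq_trans (bisetU_measure nsub) lep.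
move=> D' D'G neD; have nX := HX D' D'G neD.
apply/negP => /intersectingP[u uD' /setUP[uX|uC]].
  by move/negP: nX; apply; apply/intersectingP; exists u.
(* A core [D'] that meets [C k] but not [X] misses the tail of [e k], so its intersection with [C k]
   would be a member of [G] inside [C k]. *)
have ekD' : (e k).1 \notin D'.1.
  by apply: contra nX => ekD'; apply/intersectingP; exists (e k).1.
have IG : bisetI D' (C k) \in G.
  by apply: G_bisetI => //; [apply: inG | apply/intersectingP; exists u].
by have /negP[] := G_bsubsetF IG km kk; rewrite /bsubset /= !subsetIr.
Qed.

Theorem selected_nu : nu G <= #|V| %/ q.+1.
Proof.
have [Gp GI _ _] : semi_intersecting q G by apply: residual_semi_intersecting.
pose block D (U : {set V}) := [exists X in G, exists k : 'I_m,
  [&& kept k, (e k).1 \in X.1, U == X.1 :|: (C k).1, q < #|U| &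
    [forall D' in cores G, (D' != D) ==> ~~ intersecting D' X]]].
have exU D : exists U, D \in cores G -> block D U.
  have [DG|_] := boolP (D \in cores G); last by exists set0.
  have [X [k [XG km kk ekX [XD Xq]]]] := core_block DG.
  exists (X.1 :|: (C k).1) => _; apply/exists_inP; exists X => //.
  apply/existsP; exists (Ordinal km); apply/and5P; split=> //.
  by apply/forall_inP => D' D'G; apply/implyP => neD; apply: XD.
have [U HU] := fin_all_exists exU.
have blockP D : D \in cores G -> exists X k, [/\ X \in G, k < m, kept k, (e k).1 \in X.1 &
  [/\ forall D', D' \in cores G -> D' != D -> ~~ intersecting D' X,
      U D = X.1 :|: (C k).1 & q < #|U D|]].
  move=> /HU /exists_inP[X XG /existsP[k /and5P[kk ekX /eqP UX Uq /forall_inP XD]]].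
  exists X, k; split=> //; split=> // D' D'G neD.
  by have /implyP := XD _ D'G; apply.
have Udisj D D' u : D \in cores G -> D' \in cores G -> u \in U D -> u \in U D' -> D = D'.
  move=> DG D'G uD uD'; apply/eqP/negP => /negP neD.
  have [X [k [XG km kk ekX [XD UD _]]]] := blockP D DG.
  have [Y [l [YG lm kl elY [YD UD' _]]]] := blockP D' D'G.
  (* A core inside the intersection of [X] and [Y] would meet both, yet it differs from [D] or from
     [D']. *)
  have XY v : v \in X.1 -> v \in Y.1 -> False.
    move=> vX vY; have IG : bisetI X Y \in G.
      by apply: GI => //; apply/intersectingP; exists v.
    have [E EG] := core_exists IG; rewrite /= subsetI => /andP[EX EY].
    have /Gp/and3P[_ /set0Pn[w wE] _] : E \in G by move: EG; rewrite inE => /andP[].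
    have [ED|ED] := eqVneq E D.
      have /negP[] := YD E EG ltac:(by rewrite ED).
      by apply/intersectingP; exists w => //; apply: (subsetP EY).
    have /negP[] := XD E EG ED.
    by apply/intersectingP; exists w => //; apply: (subsetP EX).
  (* A member of [G] that avoids the tail of [e p] cannot meet [C p]: the intersection would be a
     member of [G] inside [C p]. *)
  have cross Z (T : {set V}) p v : Z \in G -> p < m -> kept p -> (e p).1 \in T ->
      (forall w, w \in Z.1 -> w \in T -> False) -> v \in Z.1 -> v \in (C p).1 -> False.
    move=> ZG pm kp epT ZT vZ vC.
    have epZ : (e p).1 \notin Z.1 by apply/negP => /ZT; apply.
    have IG : bisetI Z (C p) \in G.
      by apply: G_bisetI => //; apply/intersectingP; exists v.
    by have /negP[] := G_bsubsetF IG pm kp; rewrite /bsubset /= !subsetIr.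
  have YX v : v \in Y.1 -> v \in X.1 -> False by move=> ? ?; apply: (XY v).
  have XC v := cross X Y.1 l v XG lm kl elY XY.
  have YC v := cross Y X.1 k v YG km kk ekX YX.
  have /andP[ekC _] := e_covers km; have /andP[elC _] := e_covers lm.
  move: uD uD'; rewrite UD UD' => /setUP[uX|uk] /setUP[uY|ul].
  - exact: (XY u).
  - exact: (XC u).
  - exact: (YC u).
  (* If [C k] and [C l] meet, they are nested, and the outer one contains the tail of the edge of
     the inner one, a point of [X] or [Y] that was just excluded. *)
  have [lt_kl|lt_lk] := leqP k l.
    have /andP[s1 _] := C_nested_tail (etrans (congr1 (andb^~ _) lt_kl) lm) ul uk.
    exact: (YC _ elY (subsetP s1 _ elC)).
  have /andP[s1 _] := @C_nested_tail l k u ltac:(by rewrite ltnW) uk ul.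
  exact: (XC _ ekX (subsetP s1 _ ekC)).
(* Double counting: every block has more than [q] vertices, and every vertex lies in at most one
   block. *)
rewrite leq_divRL // /nu -sum_nat_const.
apply: (@leq_trans (\sum_(D in cores G) #|U D|)).
  by apply: leq_sum => D /blockP[X [k [_ _ _ _ [_ _ ]]]].
under eq_bigr do rewrite -sum1_card big_mkcond.
rewrite exchange_big /= -sum1_card.
apply: leq_sum => u _; rewrite -big_mkcondr sum1dep_card.
apply/card_le1_eqP => D D'.
by rewrite in_set => /andP[DG uD]; rewrite in_set => /andP[D'G uD']; apply: Udisj uD' uD.
Qed.

End ReverseSelection.

(** * Programs and their running time *)

Section Execution.
Implicit Types (p : prog) (e : expr) (s : store) (v w : tree) (T B : nat).

(** Total correctness with a time bound: a Hoare triple for a single initial store. *)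
Definition ends p s T (Q : store -> Prop) : Prop :=
  exists s' t, [/\ exec p s s' t, t <= T & Q s'].

Definition runs p v w T : Prop := ends p (init_store v) T (fun s => s 0 = w).

Lemma ends_weaken p s T T' (Q Q' : store -> Prop) :
  T <= T' -> (forall s', Q s' -> Q' s') -> ends p s T Q -> ends p s T' Q'.
Proof.
move=> leT QQ' [s' [t [ex tT Qs]]].
by exists s', t; split=> //; [lia | apply: QQ'].
Qed.

Lemma runs_weaken p v w T T' : T <= T' -> runs p v w T -> runs p v w T'.
Proof. by move=> leT; apply: ends_weaken. Qed.

Lemma ends_assign x e s T (Q : store -> Prop) :
  eval_time s e < T -> Q (upd s x (eval s e)) -> ends (PAssign x e) s T Q.
Proof.
by move=> leT Qs; exists (upd s x (eval s e)), (eval_time s e).+1; split=> //; constructor.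
Qed.

Lemma ends_seq p1 p2 s T1 T (Q : store -> Prop) :
  T1 <= T -> ends p1 s T1 (fun s1 => ends p2 s1 (T - T1) Q) ->
  ends (PSeq p1 p2) s T Q.
Proof.
move=> leT [s1 [t1 [ex1 leT1 [s2 [t2 [ex2 leT2 Qs]]]]]].
exists s2, (t1 + t2); split=> //; last by lia.
exact: exec_Seq ex1 ex2.
Qed.

Lemma ends_assign_seq x e p s T (Q : store -> Prop) :
  eval_time s e < T ->
  ends p (upd s x (eval s e)) (T - (eval_time s e).+1) Q ->
  ends (PSeq (PAssign x e) p) s T Q.
Proof.
by move=> leT H; apply: (@ends_seq _ _ _ (eval_time s e).+1) => //; apply: ends_assign.
Qed.

Lemma ends_call x p e s w B T (Q : store -> Prop) :
  runs p (eval s e) w B -> eval_time s e + B < T -> Q (upd s x w) ->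
  ends (PCall x p e) s T Q.
Proof.
move=> [s1 [t [ex tB <-]]] leT Qs.
exists (upd s x (s1 0)), (eval_time s e + t).+1; split=> //; last by lia.
exact: exec_Call.
Qed.

Lemma ends_call_seq x p e p2 s w B T (Q : store -> Prop) :
  runs p (eval s e) w B -> eval_time s e + B < T ->
  ends p2 (upd s x w) (T - (eval_time s e + B).+1) Q ->
  ends (PSeq (PCall x p e) p2) s T Q.
Proof.
move=> H leT H2; apply: (@ends_seq _ _ _ (eval_time s e + B).+1) => //.
exact: ends_call H _ H2.
Qed.

Lemma ends_if e p1 p2 s T (Q : store -> Prop) :
  eval_time s e < T ->
  ends (if truth (eval s e) then p1 else p2) s (T - (eval_time s e).+1) Q ->
  ends (PIf e p1 p2) s T Q.
Proof.
move=> leT [s1 [t [ex leT1 Qs]]].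
exists s1, (eval_time s e + t).+1; split=> //; last by lia.
exact: exec_If.
Qed.

(** [I k] is an invariant with at most [k] iterations left; [E] bounds the time of a test and [B]
    that of the body. *)
Lemma ends_while e p (I : nat -> store -> Prop) B E s k (Q : store -> Prop) :
  (forall s k, I k s -> eval_time s e <= E) ->
  (forall s k, I k s -> ~~ truth (eval s e) -> Q s) ->
  (forall s k, I k s -> truth (eval s e) -> 0 < k /\ ends p s B (I k.-1)) ->
  I k s -> ends (PWhile e p) s (k * (E + B).+1 + E.+1) Q.
Proof.
move=> HE HQ HB; elim: k s => [|k IH] s Is.
  case: (boolP (truth (eval s e))) => [|cond].
    by move=> /(HB _ _ Is)[].
  exists s, (eval_time s e).+1; split; first exact: exec_While_end.
    by have := HE _ _ Is; lia.
  exact: HQ Is cond.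
case: (boolP (truth (eval s e))) => cond.
  have [_ [s1 [t1 [ex1 leB I1]]]] := HB _ _ Is cond.
  have [s2 [t2 [ex2 leT Qs]]] := IH _ I1.
  exists s2, (eval_time s e + t1 + t2).+1; split=> //.
    exact: exec_While_loop ex1 ex2.
  by have := HE _ _ Is; rewrite mulSn; move: (k * _) leT => z; lia.
exists s, (eval_time s e).+1; split; first exact: exec_While_end.
  by have := HE _ _ Is; lia.
exact: HQ Is cond.
Qed.

Definition tlist (l : seq tree) : tree := foldr TCons TNil l.

Lemma tlist_size (l : seq tree) :
  tsize (tlist l) = (\sum_(v <- l) tsize v + size l).+1.
Proof.
by elim: l => [|v l IH] /=; rewrite ?big_nil // big_cons IH; lia.
Qed.

(* The input is [(param, list)]; [step] gets [((param, element), accumulator)]. *)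
Definition pfold (step : prog) : prog :=
  PSeq (PAssign 1 (ETail (EVar 0)))
  (PSeq (PAssign 3 (EHead (EVar 0)))
  (PSeq (PWhile (EIsCons (EVar 1))
     (PSeq (PCall 2 step
              (ECons (ECons (EVar 3) (EHead (EVar 1))) (EVar 2)))
           (PAssign 1 (ETail (EVar 1)))))
   (PAssign 0 (EVar 2)))).

Definition fold_time T k := (T + 15) * k + 15.

(** The step need only be correct on accumulators arising from prefixes of [l], so that [T] may
    depend on their size. The accumulator starts as [TNil], the value of the unassigned variable
    2. *)
Lemma pfold_runs (A S : Type) (code : A -> tree) (acode : S -> tree)
    (step : prog) (g : S -> A -> S) (z : S) param (l : seq A) T :
  acode z = TNil ->
  (forall l1 a l2, l = l1 ++ a :: l2 -> let b := foldl g z l1 in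
     runs step (TCons (TCons param (code a)) (acode b)) (acode (g b a)) T) ->
  runs (pfold step) (TCons param (tlist (map code l))) (acode (foldl g z l))
    (fold_time T (size l)).
Proof.
move=> z0 Hstep; rewrite /fold_time.
apply: ends_assign_seq => /=; first by lia.
apply: ends_assign_seq => /=; first by lia.
apply: (@ends_seq _ _ _ (size l * (2 + (T + 10)).+1 + 3)); first by lia.
pose I k s := exists l1 l2, [/\ l = l1 ++ l2, size l2 = k,
  s 1 = tlist (map code l2), s 2 = acode (foldl g z l1) & s 3 = param].
apply: (@ends_while _ _ I).
- by move=> s k _ /=; lia.
- move=> s k [l1 [[|a l2] [El _ s1 s2 s3]]] /=; rewrite s1 //= => _.
  apply: ends_assign => /=; first by lia.
  by rewrite /upd /= s2 El cats0.
- move=> s k [l1 [[|a l2] [El Ek s1 s2 s3]]] /=; rewrite s1 //= => _.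
  split; first by rewrite -Ek.
  apply: (@ends_call_seq _ _ _ _ _ (acode (g (foldl g z l1) a)) T).
  + by rewrite /= s1 s2 s3 /=; apply: Hstep El.
  + by rewrite /=; lia.
  apply: ends_assign => /=; first by lia.
  exists (l1 ++ [:: a]), l2; rewrite -catA /= foldl_cat /upd /= s1 s3.
  by split=> //; rewrite -Ek.
- by exists [::], l; rewrite /upd /= /init_store /upd /=.
Qed.

End Execution.

(** * Subroutines on encoded vertices, edges and cores *)

Section Procedures.
Variable n : nat.
Implicit Types (i j : 'I_n) (e : 'I_n * 'I_n) (c : seq 'I_n * seq 'I_n).

Definition vtree i : tree := TNum (i%:R)%R.
Definition etree e : tree := TCons (vtree e.1) (vtree e.2).
Definition wtree (w : ('I_n * 'I_n) * rat) : tree := TCons (etree w.1) (TNum w.2).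
Definition ctree c : tree :=
  TCons (tlist (map vtree c.1)) (tlist (map vtree c.2)).
Definition ptree (p : (seq 'I_n * seq 'I_n) * ('I_n * 'I_n)) : tree :=
  TCons (ctree p.1) (etree p.2).
Definition otree (o : option (('I_n * 'I_n) * rat)) : tree := oapp wtree TNil o.

Definition lcovers e c : bool := (e.1 \in c.1) && (e.2 \notin c.2).

Let ETrue := ECons ENil ENil.
Let acc := ETail (EVar 0).
Let elt := ETail (EHead (EVar 0)).
Let param := EHead (EHead (EVar 0)).

(** Equality of vertices takes two comparisons, [Leq] being the only test on numbers. *)
Definition pmem : prog := pfold
  (PIf (EBin Leq param elt)
     (PIf (EBin Leq elt param) (PAssign 0 ETrue) (PAssign 0 acc))
     (PAssign 0 acc)).

Definition pcovers : prog :=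
  PSeq (PCall 1 pmem (ECons (EHead (EHead (EVar 0))) (EHead (ETail (EVar 0)))))
  (PSeq (PCall 2 pmem (ECons (ETail (EHead (EVar 0))) (ETail (ETail (EVar 0)))))
  (PIf (EVar 1)
     (PIf (EVar 2) (PAssign 0 ENil) (PAssign 0 ETrue))
     (PAssign 0 ENil))).

Definition phas : prog := pfold
  (PSeq (PCall 1 pcovers (ECons elt param))
  (PIf (EVar 1) (PAssign 0 ETrue) (PAssign 0 acc))).

Definition pmin : prog := pfold
  (PSeq (PCall 1 pcovers (ECons (EHead elt) param))
  (PIf (EVar 1)
     (PIf acc
        (PIf (EBin Leq (ETail acc) (ETail elt)) (PAssign 0 acc) (PAssign 0 elt))
        (PAssign 0 elt))
     (PAssign 0 acc))).

Definition preduce : prog := pfold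
  (PSeq (PCall 1 pcovers (ECons (EHead elt) (EHead param)))
  (PIf (EVar 1)
     (PAssign 0 (ECons (ECons (EHead elt) (EBin Defs.Sub (ETail elt) (ETail param))) acc))
     (PAssign 0 (ECons elt acc)))).

Definition pselect : prog := pfold
  (PSeq (PCall 1 phas (ECons (EHead elt) acc))
  (PIf (EVar 1) (PAssign 0 acc) (PAssign 0 (ECons (ETail elt) acc)))).

(** A crude linear bound suffices, because the input lists all vertices and so is longer than their
    number. *)
Lemma bits_nat k : bits (k%:R)%R <= k.+2.
Proof.
rewrite /bits pmulrn numq_int denq_int /= trunc_log1.
suff : trunc_log 2 k <= k by lia.
case: k => [|k]; first by rewrite trunc_log0.
have := trunc_logP (isT : 1 < 2) (ltn0Sn k).
by have := ltn_expl (trunc_log 2 k.+1) (isT : 1 < 2); lia.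
Qed.

Variable N : nat.
Hypothesis n_le_N : n.+1 <= N.

Lemma bits_vtree i : bits (i%:R)%R <= N.
Proof. by apply: leq_trans (bits_nat i) _; have := ltn_ord i; lia. Qed.

Lemma uniq_size (l : seq 'I_n) : uniq l -> size l <= N.
Proof.
by move/card_uniqP <-; apply: leq_trans (max_card _) _; rewrite card_ord ltnW.
Qed.

Definition mem_time := fold_time (4 * N + 40) N.

Lemma fold_time_mono T k k' : k <= k' -> fold_time T k <= fold_time T k'.
Proof. by move=> lek; rewrite leq_add2r leq_mul2l lek orbT. Qed.

Lemma pmem_runs i (l : seq 'I_n) : uniq l ->
  runs pmem (TCons (vtree i) (tlist (map vtree l))) (of_bool (i \in l)) mem_time.
Proof.
move=> /uniq_size lN.
apply: (@runs_weaken _ _ _ (fold_time (4 * N + 40) (size l))).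
  exact: fold_time_mono.
have -> : (i \in l) = foldl (fun b j => (i == j) || b) false l.
  suff H b : foldl (fun b j => (i == j) || b) b l = (i \in l) || b by rewrite H orbF.
  elim: l {lN} b => //= j l IH b; rewrite IH inE.
  by rewrite orbCA orbA.
apply: pfold_runs => // l1 j l2 _ /=; move: (foldl _ _ _) => b.
have bi := bits_vtree i; have bj := bits_vtree j.
apply: ends_if; rewrite /=; first by lia.
rewrite Num.Theory.ler_nat.
have [ij|ij] /= := leqP i j; last first.
  apply: ends_assign => /=; first by lia.
  rewrite /upd /=; case: eqP => // E; move: ij; rewrite E ltnn //.
apply: ends_if; rewrite /=; first by lia.
rewrite Num.Theory.ler_nat.
have [ji|ji] /= := leqP j i; last first.
  apply: ends_assign => /=; first by lia.
  rewrite /upd /=; case: eqP => // E; move: ji; rewrite E ltnn //.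
apply: ends_assign => /=; first by lia.
have -> : i = j by apply/val_inj/eqP; rewrite eqn_leq ij.
by rewrite eqxx.
Qed.

Definition uniq2 c := uniq c.1 && uniq c.2.

Definition covers_time := 2 * mem_time + 40.

Lemma pcovers_runs e c : uniq2 c ->
  runs pcovers (TCons (etree e) (ctree c)) (of_bool (lcovers e c)) covers_time.
Proof.
move=> /andP[u1 u2]; rewrite /covers_time.
apply: ends_call_seq; [exact: pmem_runs u1 | by rewrite /=; lia | rewrite /=].
apply: ends_call_seq; [exact: pmem_runs u2 | by rewrite /=; lia | rewrite /=].
rewrite /lcovers.
apply: ends_if; rewrite /upd /=; first by lia.
case: (_ \in c.1) => /=; last by apply: ends_assign => /=; first by lia.
apply: ends_if; rewrite /upd /=; first by lia.
by case: (_ \in c.2) => /=; apply: ends_assign => //=; lia.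
Qed.

Definition has_time k := fold_time (covers_time + 40) k.

Lemma phas_runs c (l : seq ('I_n * 'I_n)) : uniq2 c ->
  runs phas (TCons (ctree c) (tlist (map etree l)))
    (of_bool (has (fun e => lcovers e c) l)) (has_time (size l)).
Proof.
move=> uc.
have -> : has (fun e => lcovers e c) l = foldl (fun b e => lcovers e c || b) false l.
  suff H b : foldl (fun b e => lcovers e c || b) b l =
    has (fun e => lcovers e c) l || b by rewrite H orbF.
  by elim: l b => //= e l IH b; rewrite IH; case: lcovers; case: b; rewrite ?orbT.
apply: pfold_runs => // l1 e l2 _ /=; move: (foldl _ _ _) => b.
apply: ends_call_seq; [exact: pcovers_runs uc | by rewrite /=; lia | rewrite /=].
apply: ends_if; rewrite /upd /=; first by lia.
by case: lcovers => /=; apply: ends_assign => //=; lia.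
Qed.

Definition choose_min c (o : option (('I_n * 'I_n) * rat)) w :=
  if lcovers w.1 c then
    if o is Some w' then if (w'.2 <= w.2)%R then o else Some w else Some w
  else o.

Lemma choose_minP c (l : seq (('I_n * 'I_n) * rat)) :
  match foldl (choose_min c) None l with
  | Some w => [/\ w \in l, lcovers w.1 c &
      forall w', w' \in l -> lcovers w'.1 c -> (w.2 <= w'.2)%R]
  | None => forall w', w' \in l -> ~~ lcovers w'.1 c
  end.
Proof.
elim/last_ind: l => //= l w; rewrite foldl_rcons {2}/choose_min /choose_min.
rewrite -/(choose_min c); case: (foldl _ _ _) => [w0 [w0l cw0 w0min]|H].
  have [cw|cw] := boolP (lcovers w.1 c); last first.
    split=> // [|w']; rewrite mem_rcons inE ?w0l ?orbT // => /orP[/eqP->|]; last exact: w0min.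
    by rewrite (negPf cw).
  have [le0|lt0] := Order.TotalTheory.leP w0.2 w.2.
    split=> // [|w']; rewrite mem_rcons inE ?w0l ?orbT // => /orP[/eqP->//|].
    exact: w0min.
  split=> // [|w']; rewrite mem_rcons inE ?eqxx // => /orP[/eqP->//|w'l cw'].
  by apply: Order.POrderTheory.ltW; apply: Order.POrderTheory.lt_le_trans lt0 (w0min _ w'l cw').
have [cw|cw] := boolP (lcovers w.1 c).
  split=> // [|w']; rewrite mem_rcons inE ?eqxx // => /orP[/eqP->//|w'l cw'].
  by have := H _ w'l; rewrite cw'.
by move=> w'; rewrite mem_rcons inE => /orP[/eqP->//|]; apply: H.
Qed.

Definition min_time B k := fold_time (covers_time + 2 * B + 60) k.

Lemma pmin_runs c (l : seq (('I_n * 'I_n) * rat)) B : uniq2 c ->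
  (forall w : ('I_n * 'I_n) * rat, w \in l -> bits w.2 <= B) ->
  runs pmin (TCons (ctree c) (tlist (map wtree l)))
    (otree (foldl (choose_min c) None l)) (min_time B (size l)).
Proof.
move=> uc lB; apply: pfold_runs => // l1 w l2 El /=.
have wl : w \in l by rewrite El mem_cat mem_head orbT.
have := choose_minP c l1; case: (foldl _ _ _) => [w0 [w0l _ _]|_].
  have {}w0l : w0 \in l by rewrite El mem_cat w0l.
  have bw := lB _ wl; have bw0 := lB _ w0l.
  apply: ends_call_seq; [exact: pcovers_runs uc | by rewrite /=; lia | rewrite /=].
  apply: ends_if; rewrite /upd /=; first by lia.
  rewrite /choose_min; case: lcovers => /=; last by apply: ends_assign => //=; lia.
  apply: ends_if; rewrite /=; first by lia.
  apply: ends_if; rewrite /=; first by lia.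
  by case: (_ <= _)%R => /=; apply: ends_assign => //=; lia.
apply: ends_call_seq; [exact: pcovers_runs uc | by rewrite /=; lia | rewrite /=].
apply: ends_if; rewrite /upd /=; first by lia.
rewrite /choose_min; case: lcovers => /=; last by apply: ends_assign => //=; lia.
apply: ends_if; rewrite /=; first by lia.
by apply: ends_assign => //=; lia.
Qed.

Definition reduce c (y : rat) (w : ('I_n * 'I_n) * rat) :=
  if lcovers w.1 c then (w.1, w.2 - y)%R else w.

Definition reduce_all c y (l : seq (('I_n * 'I_n) * rat)) :=
  foldl (fun b w => reduce c y w :: b) [::] l.

Lemma reduce_allE c y l : reduce_all c y l = rev (map (reduce c y) l).
Proof.
rewrite /reduce_all; elim/last_ind: l => // l w IH.
by rewrite foldl_rcons map_rcons rev_rcons IH.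
Qed.

Lemma preduce_runs c y (l : seq (('I_n * 'I_n) * rat)) B : uniq2 c -> bits y <= B ->
  (forall w : ('I_n * 'I_n) * rat, w \in l -> bits w.2 <= B) ->
  runs preduce (TCons (TCons (ctree c) (TNum y)) (tlist (map wtree l)))
    (tlist (map wtree (reduce_all c y l))) (min_time B (size l)).
Proof.
move=> uc yB lB.
apply: (pfold_runs (acode := fun l => tlist (map wtree l))) => // l1 w l2 El /=.
have bw : bits w.2 <= B by apply: lB; rewrite El mem_cat mem_head orbT.
move: (foldl _ _ _) => b.
apply: ends_call_seq; [exact: pcovers_runs uc | by rewrite /=; lia | rewrite /=].
apply: ends_if; rewrite /upd /=; first by lia.
by rewrite /reduce; case: lcovers => /=; apply: ends_assign => //=; lia.
Qed.

Definition select_step (A : seq ('I_n * 'I_n)) (p : (seq 'I_n * seq 'I_n) * ('I_n * 'I_n)) :=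
  if has (fun e => lcovers e p.1) A then A else p.2 :: A.

Definition select_time k := fold_time (has_time k + 40) k.

Lemma pselect_runs (l : seq ((seq 'I_n * seq 'I_n) * ('I_n * 'I_n))) :
  (forall p, p \in l -> uniq2 p.1) ->
  runs pselect (TCons TNil (tlist (map ptree l)))
    (tlist (map etree (foldl select_step [::] l))) (select_time (size l)).
Proof.
move=> lu.
apply: (pfold_runs (acode := fun l => tlist (map etree l))) => // l1 p l2 El /=.
have up : uniq2 p.1 by apply: lu; rewrite El mem_cat mem_head orbT.
(* At most one edge is added per step, which bounds the time of each call to [phas]. *)
have size1 : size (foldl select_step [::] l1) <= size l.
  have -> : size l = size l1 + (size l2).+1 by rewrite El size_cat.
  suff H A : size (foldl select_step A l1) <= size A + size l1 by have := H [::]; rewrite /=; lia.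
  elim: l1 A {El} => [|x l1 IH] A /=; first by lia.
  have := IH (select_step A x); have : size (select_step A x) <= (size A).+1.
    by rewrite /select_step; case: ifP => //= _; lia.
  by lia.
move: (foldl _ _ _) size1 => A sizeA.
apply: (@ends_call_seq _ _ _ _ _ (of_bool (has (fun e => lcovers e p.1) A)) (has_time (size l))).
- rewrite /=; apply: runs_weaken (phas_runs A up); exact: fold_time_mono.
- by rewrite /=; lia.
apply: ends_if; rewrite /upd /=; first by lia.
rewrite /select_step; case: has => /=; apply: ends_assign => //=; lia.
Qed.

End Procedures.

(** * Primal-dual histories *)

Lemma trunc_log_lt x M : 0 < x -> x < 2 ^ M -> trunc_log 2 x < M.
Proof.
move=> x0 xM; rewrite -(ltn_exp2l _ _ (isT : 1 < 2)).
exact: leq_ltn_trans (trunc_logP _ x0) xM.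
Qed.

(** The denominator of [r] divides [D], and its numerator is at most [D] times that of [b], because
    [b] is at most its own numerator. *)
Lemma bits_le (r b : rat) (D M : nat) : (0 <= r <= b)%R -> 0 < D ->
  (r * D%:R)%R \is a Num.int -> D < 2 ^ M -> bits r <= 2 * M + bits b.
Proof.
move=> /andP[r0 rb] D0 /intrP[z Ez] DM.
have dr0 : 0 < `|denq r|%N by rewrite absz_gt0 denq_neq0.
have dvd : (`|denq r| %| D)%N.
  have E : (numq r * D%:Z = z * denq r)%R.
    apply: (@intr_inj rat); rewrite !rmorphM /= numqE -Ez /= pmulrn.
    by rewrite -!mulrA [(D%:~R * _)%R]mulrC.
  have := congr1 absz E; rewrite !abszM /= => En.
  rewrite -(@Gauss_dvdr _ `|numq r|%N); last by rewrite coprime_sym coprime_num_den.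
  by rewrite En dvdn_mull.
have dD := dvdn_leq D0 dvd.
have nb : `|numq r| <= `|numq b| * D.
  have b0 := le_trans r0 rb.
  have nr0 : (0 <= numq r)%R by rewrite numq_ge0.
  have nb0 : (0 <= numq b)%R by rewrite numq_ge0.
  rewrite -lez_nat PoszM !gez0_abs // -(ler_int rat) rmorphM /= numqE.
  apply: ler_pM => //; first by rewrite ler0z denq_ge0.
    apply: le_trans rb _; rewrite numqE ler_peMr //.
    by rewrite -[1%R]/(1%:~R)%R ler_int -gtz0_ge1 denq_gt0.
  by rewrite ler_int -[denq r]gez0_abs ?denq_ge0 // lez_nat.
have l1 : trunc_log 2 `|denq r| < M by apply: trunc_log_lt => //; lia.
have l2 : trunc_log 2 `|numq r| < M + (trunc_log 2 `|numq b|).+1.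
  have [->|n0] := posnP `|numq r|; first by rewrite trunc_log0; lia.
  apply: trunc_log_lt => //; rewrite expnD mulnC.
  apply: leq_ltn_trans nb _; apply: ltn_mul => //; exact: trunc_log_ltn.
by rewrite /bits; lia.
Qed.

Section PrimalDual.
Variables (n q : nat) (F : {set biset 'I_n}) (E : {set 'I_n * 'I_n}).
Variable c : 'I_n * 'I_n -> rat.
Hypothesis Fsemi : semi_intersecting q F.
Hypothesis c_ge0 : forall e, e \in E -> (0 <= c e)%R.

(* In [((C, e), y)], the core [C] gets the dual value [y], making [e] tight.
   A history lists the most recent purchase first. *)
Definition purchase := (((seq 'I_n * seq 'I_n) * ('I_n * 'I_n)) * rat)%type.
Implicit Types (s : seq purchase) (p : purchase) (e : 'I_n * 'I_n).

Definition biset_of (C : seq 'I_n * seq 'I_n) : biset 'I_n :=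
  ([set i in C.1], [set i in C.2]).

Lemma covers_biset_of e C : covers e (biset_of C) = lcovers e C.
Proof. by rewrite /covers /lcovers !inE. Qed.

(** The slack of the dual constraint of [e] under the dual values recorded in [s]. *)
Definition reduced_cost s e : rat :=
  (c e - \sum_(p <- s | lcovers e p.1.1) p.2)%R.

Definition edges s : seq ('I_n * 'I_n) := [seq p.1.2 | p <- s].

Definition bought s : {set 'I_n * 'I_n} := [set e in edges s].

(** Any run of the primal-dual phase: which core is taken and how ties are broken is left open. *)
Fixpoint history s : Prop :=
  if s is (C, e, y) :: s' then
    [/\ history s', uniq2 C, biset_of C \in cores (residual F (bought s')),
        e \in E /\ lcovers e C
      & y = reduced_cost s' e /\
        forall e', e' \in E -> lcovers e' C -> (y <= reduced_cost s' e')%R]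
  else True.

Lemma reduced_cost_cons p s e : reduced_cost (p :: s) e =
  (if lcovers e p.1.1 then reduced_cost s e - p.2 else reduced_cost s e)%R.
Proof.
rewrite /reduced_cost big_cons; case: ifP => // _.
by rewrite opprD addrA addrAC.
Qed.

Lemma core_uncovered s C e :
  biset_of C \in cores (residual F (bought s)) -> e \in edges s -> ~~ lcovers e C.
Proof.
rewrite inE => /andP[/residualP[_ H] _] es.
by rewrite -covers_biset_of H // inE.
Qed.

(** Dual feasibility: each raise is the least slack among the edges that it affects. *)
Lemma reduced_cost_ge0 s e : history s -> e \in E -> (0 <= reduced_cost s e)%R.
Proof.
elim: s => [_|[[C e0] y] s IH] /=.
  by move=> eE; rewrite /reduced_cost big_nil subr0 c_ge0.
move=> [hs _ _ _ [_ ymin]] eE; rewrite reduced_cost_cons /=.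
by case: ifP => [eC|_]; [rewrite subr_ge0; apply: ymin | apply: IH].
Qed.

Lemma history_tail s1 s2 : history (s1 ++ s2) -> history s2.
Proof. by elim: s1 => //= -[[C e] y] s1 IH [/IH]. Qed.

Lemma purchase_ge0 s p : history s -> p \in s -> (0 <= p.2)%R.
Proof.
elim: s => //= -[[C e] y] s IH [hs _ _ [eE _] [-> _]].
rewrite inE => /orP[/eqP->|]; last exact: IH.
exact: reduced_cost_ge0.
Qed.

Lemma purchase_uniq2 s p : history s -> p \in s -> uniq2 p.1.1.
Proof.
elim: s => //= -[[C e] y] s IH [hs u _ _ _].
by rewrite inE => /orP[/eqP->//|]; apply: IH.
Qed.

Lemma reduced_cost_le s e : history s -> (reduced_cost s e <= c e)%R.
Proof.
move=> hs; rewrite lerBlDr lerDl big_seq_cond.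
by apply: sumr_ge0 => p /andP[ps _]; apply: purchase_ge0 hs ps.
Qed.

Lemma edges_sub s : history s -> {subset edges s <= E}.
Proof.
elim: s => //= -[[C e] y] s IH [hs _ _ [eE _] _] x.
by rewrite inE => /orP[/eqP->//|]; apply: IH.
Qed.

Lemma edges_uniq s : history s -> uniq (edges s).
Proof.
elim: s => //= -[[C e] y] s IH [hs _ Ccore [_ eC] _] /=.
rewrite IH // andbT; apply: contraL eC; exact: core_uncovered.
Qed.

(** Every purchase buys a new edge, since no bought edge covers the chosen core. This bounds the
    number of iterations. *)
Lemma history_size s : history s -> size s <= #|E|.
Proof.
move=> hs; rewrite -(size_map (fun p => p.1.2)) -(card_uniqP (edges_uniq hs)).
by apply: subset_leq_card; apply/subsetP => x; apply: edges_sub.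
Qed.

(** The slack vanishes at the purchase and stays unchanged, as a bought edge covers no core chosen
    later. *)
Lemma edges_tight s e : history s -> e \in edges s -> reduced_cost s e = 0%R.
Proof.
elim: s => //= -[[C e0] y] s IH [hs _ Ccore [_ eC] [-> _]].
rewrite inE reduced_cost_cons /= => /orP[/eqP->|es].
  by rewrite eC subrr.
by rewrite (negPf (core_uncovered Ccore es)) IH.
Qed.

Definition common_den : nat := \prod_(e in E) `|denq (c e)|%N.

(** The raised amounts are themselves reduced costs, so only differences of multiples of
    [1 / common_den] ever occur. *)
Lemma reduced_cost_int s e : history s -> e \in E ->
  (reduced_cost s e * common_den%:R)%R \is a Num.int.
Proof.
elim: s e => [|[[C e0] y] s IH] e /=.
  move=> _ eE; rewrite /reduced_cost big_nil subr0 /common_den (bigD1 e) //=.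
  rewrite natrM mulrA rpredM ?natr_int //.
  have -> : ((`|denq (c e)|%N)%:R = (denq (c e))%:~R :> rat)%R.
    by rewrite pmulrn gez0_abs // denq_ge0.
  by rewrite -numqE intr_int.
move=> [hs _ _ [e0E _] [-> _]] eE; rewrite reduced_cost_cons /=.
case: ifP => _; last exact: IH.
by rewrite mulrBl; apply: rpredB; apply: IH.
Qed.

Lemma common_den_gt0 : 0 < common_den.
Proof. by apply: prodn_cond_gt0 => e _; rewrite absz_gt0 denq_neq0. Qed.

Lemma common_den_lt : common_den < 2 ^ (\sum_(e in E) bits (c e)).+1.
Proof.
have : common_den <= 2 ^ (\sum_(e in E) bits (c e)).
  rewrite expn_sum; apply: leq_prod => e _.
  apply: ltnW; apply: leq_trans (trunc_log_ltn _ (isT : 1 < 2)) _.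
  by rewrite leq_exp2l // /bits leq_addl.
by move=> le; apply: leq_ltn_trans le _; rewrite ltn_exp2l.
Qed.

Lemma reduced_cost_bits s e N : history s -> e \in E ->
  \sum_(e in E) bits (c e) <= N -> bits (reduced_cost s e) <= 3 * N + 2.
Proof.
move=> hs eE leN.
(* The exponent is at most [N + 1], whence [2 * (N + 1) + N]. *)
have := @bits_le (reduced_cost s e) (c e) _ _ _ common_den_gt0
  (reduced_cost_int hs eE) common_den_lt.
rewrite reduced_cost_ge0 ?reduced_cost_le // => /(_ isT).
have : bits (c e) <= \sum_(e in E) bits (c e) by rewrite (bigD1 e) //= leq_addr.
by lia.
Qed.

Definition selection s := foldl (@select_step n) [::] (map fst s).

Lemma dual_le_tau (R : realType) (tau : R) s : history s -> is_tau F E c tau ->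
  (ratr (\sum_(p <- s) p.2) <= tau)%R.
Proof.
move=> hs [[x [x0 xF] <-] _]; rewrite /lp_value.
(* Weak duality: the middle term weighs [x] by the dual load of each edge. Primal feasibility bounds
   it from below, dual feasibility from above. *)
apply: (@le_trans _ _ (\sum_(e in E) ratr (\sum_(p <- s | lcovers e p.1.1) p.2) * x e)%R).
  under [leRHS]eq_bigr do rewrite rmorph_sum mulr_suml big_mkcond /=.
  rewrite exchange_big /= rmorph_sum /= big_seq [leRHS]big_seq.
  apply: ler_sum => p ps.
  have y0 := purchase_ge0 hs ps.
  rewrite -big_mkcondr /= -mulr_sumr -[leLHS]mulr1.
  apply: ler_wpM2l; first by rewrite ler0q.
  have pF : biset_of p.1.1 \in F.
    elim: s hs ps {y0} => //= -[[C e] y] s IH [hs _ Ccore _ _].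
    rewrite inE => /orP[/eqP->/=|]; last exact: IH.
    by move: Ccore; rewrite inE => /andP[/residualP[]].
  apply: le_trans (xF _ pF) _; rewrite le_eqVlt; apply/orP; left; apply/eqP.
  by apply: eq_bigl => e; rewrite !inE covers_biset_of.
apply: ler_sum => e eE; apply: ler_wpM2r; first exact: x0.
by rewrite ler_rat -subr_ge0; apply: reduced_cost_ge0.
Qed.

(** * Cost and number of uncovered cores for the selected edges *)

Section Selection.
Variable s : seq purchase.
Hypothesis hs : history s.
Hypothesis complete : residual F (bought s) = set0.
Variable p0 : purchase.

Let C i := biset_of (nth p0 s i).1.1.
Let e i := (nth p0 s i).1.2.

(** The edges [e j] with [j > i] are those of [drop i.+1 s], the purchases made before [C i] was
    chosen. *)
Lemma history_core i : i < size s -> C i \in cores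
  (residual F [set x | [exists j : 'I_(size s), (i < j) && (x == e j)]]).
Proof.
move=> im; have := hs; rewrite -{1}(cat_take_drop i s) => /history_tail.
rewrite (drop_nth p0 im) /C /=; case: (nth p0 s i) => -[Ci ei] y /= [_ _ + _ _].
congr (_ \in cores (residual F _)); apply/setP => x; rewrite !inE.
apply/mapP/existsP => [[p /(nthP p0)[j]]|[j /andP[ij /eqP->]]].
  rewrite size_drop nth_drop => js <- ->.
  have lt : i.+1 + j < size s by rewrite -ltn_subRL.
  by exists (Ordinal lt); rewrite /= eqxx andbT leq_addr.
exists (nth p0 s j) => //.
have -> : nth p0 s j = nth p0 (drop i.+1 s) (j - i.+1).
  by rewrite nth_drop subnKC.
by apply: mem_nth; rewrite size_drop ltn_sub2r // (leq_ltn_trans ij).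
Qed.

Lemma history_covers i : i < size s -> covers (e i) (C i).
Proof.
move=> im; have := hs; rewrite -{1}(cat_take_drop i s) => /history_tail.
rewrite (drop_nth p0 im) /C /e covers_biset_of.
by case: (nth p0 s i) => -[Ci ei] y /= [_ _ _ [_]].
Qed.

Lemma history_complete X : X \in F -> exists2 i, i < size s & covers (e i) X.
Proof.
move=> XF; have : X \notin residual F (bought s) by rewrite complete inE.
rewrite inE XF /= => /set0Pn[x]; rewrite !inE => /andP[/mapP[p /(nthP p0)[i im <-] ->] cX].
by exists i.
Qed.

Lemma selection_select : selection s = select C e (size s).
Proof.
suff H k : k <= size s ->
    foldl (@select_step n) [::] (map fst (take k s)) = select C e k.
  by rewrite -H // take_size.
elim: k => [|k IH] lek; first by rewrite take0.
rewrite (take_nth p0) // map_rcons foldl_rcons IH ?(ltnW lek) //=.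
rewrite /select_step -/(e k); congr (if _ then _ else _).
by apply: eq_has => x; rewrite covers_biset_of.
Qed.

Let J := [set x in selection s].

Lemma J_selected : J = selected (size s) C e.
Proof. by rewrite /J selection_select. Qed.

Lemma nu_selection : nu (residual F J) <= n %/ q.+1.
Proof.
have := selected_nu Fsemi history_core history_covers history_complete.
by rewrite J_selected card_ord.
Qed.

Lemma mem_J x : x \in J -> exists i, [/\ i < size s, kept C e i & x = e i].
Proof. by rewrite J_selected => /mem_selected. Qed.

Lemma J_edges : {subset J <= edges s}.
Proof.
move=> x /mem_J[i [im _ ->]]; apply/mapP; exists (nth p0 s i) => //.
exact: mem_nth.
Qed.

(** Selected edges are tight, so their cost is a sum of dual values; each value counts at most once,
    as at most one selected edge covers its core. *)
Lemma J_cost : (\sum_(x in J) c x <= \sum_(p <- s) p.2)%R.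
Proof.
have -> : (\sum_(x in J) c x = \sum_(x in J) \sum_(p <- s | lcovers x p.1.1) p.2)%R.
  apply: eq_bigr => x xJ; apply/eqP; rewrite -subr_eq0; apply/eqP.
  exact: edges_tight (J_edges xJ).
under eq_bigr do rewrite big_mkcond /=.
rewrite exchange_big /= big_seq [leRHS]big_seq; apply: ler_sum => p ps.
rewrite -big_mkcondr /= sumr_const.
set A := (X in #|X|); suff : #|A| <= 1.
  by case: #|A| => [|[|k]] // _; rewrite ?mulr0n ?mulr1n ?(purchase_ge0 hs ps).
apply/card_le1_eqP => x x'; rewrite !unfold_in /=.
move=> /andP[/mem_J[k [km kk ->]] ck] /andP[/mem_J[l [lm kl ->]] cl].
have [i im Ei] := nthP p0 ps.
have CE y : lcovers y p.1.1 = covers y (C i) by rewrite /C Ei covers_biset_of.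
rewrite !CE in ck cl.
have once := selected_once Fsemi history_core history_covers im.
by rewrite (once _ _ km lm kk kl ck cl).
Qed.

End Selection.

Lemma selection_uniq s : history s -> uniq (selection s).
Proof.
(* The accumulator stays disjoint from the edges yet to be scanned. *)
rewrite /selection => hs; suff H A : uniq A -> (forall x, x \in A -> x \notin edges s) ->
  uniq (foldl (@select_step n) A (map fst s)) by apply: H.
elim: s hs A => //= -[[C e] y] s IH [hs _ Ccore [_ eC] _] A uA HA.
have tl x : x \in A -> x \notin edges s.
  by move=> /HA; rewrite inE negb_or => /andP[].
rewrite {2}/select_step /=; case: ifP => _; first exact: IH.
apply: IH => // [|x].
  by rewrite /= uA andbT; apply/negP => /HA; rewrite inE eqxx.
rewrite inE => /orP[/eqP->|/tl//].
by apply: contraL eC; apply: core_uncovered.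
Qed.

Theorem selectionP (R : realType) (tau : R) s (J := [set x in selection s]) :
  history s -> residual F (bought s) = set0 -> is_tau F E c tau ->
  [/\ J \subset E, nu (residual F J) <= n %/ q.+1
    & (ratr (\sum_(e in J) c e) <= tau)%R].
Proof.
move=> hs complete tauP.
have cost_le : (\sum_(e in J) c e <= \sum_(p <- s) p.2)%R ->
    (ratr (\sum_(e in J) c e) <= tau)%R.
  by move=> le; apply: le_trans (dual_le_tau hs tauP); rewrite ler_rat.
(* The empty history has no purchase to serve as the default [p0] of [nth]; in this case [F] itself
   is empty. *)
case: s => [|p0 s0] in J hs complete cost_le *.
  have J0 : J = set0 by apply/setP => x; rewrite !inE.
  split; first by rewrite J0 sub0set.
    have -> : J = bought [::] by apply/setP => x; rewrite !inE.
    rewrite complete.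
    rewrite /nu; have -> : cores set0 = set0 :> {set biset 'I_n}.
      by apply/setP => X; rewrite !inE.
    by rewrite cards0.
  by apply: cost_le; rewrite J0 big_set0 big_nil.
split.
- by apply/subsetP => x xJ; apply: (edges_sub hs); apply: (J_edges p0).
- exact: nu_selection hs complete p0.
- by apply: cost_le; apply: (J_cost hs p0).
Qed.

End PrimalDual.

(** * The algorithm *)

Section Codes.
Variables (T : finType) (code : T -> tree -> Prop) (f : T -> tree).

Lemma seq_code_inv (l : seq T) v :
  (forall a u, code a u -> u = f a) -> seq_code code l v -> v = tlist (map f l).
Proof.
move=> codeE; elim: l v => [|a l IH] [|r|h t] //= [/codeE-> /IH->] //.
Qed.

Lemma seq_code_tlist (l : seq T) :
  (forall a, code a (f a)) -> seq_code code l (tlist (map f l)).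
Proof. by move=> codef; elim: l => //= a l IH; split. Qed.

End Codes.

Section InstanceCodes.
Variable n : nat.

Lemma edge_code_etree (e : 'I_n * 'I_n) : edge_code e (etree e).
Proof. by exists (vtree e.1), (vtree e.2). Qed.

Lemma set_code_edges (l : seq ('I_n * 'I_n)) : uniq l ->
  set_code (@edge_code n) [set e in l] (tlist (map (@etree n) l)).
Proof.
move=> ul; exists l; split=> //; first by move=> e; rewrite inE.
exact/seq_code_tlist/edge_code_etree.
Qed.

Lemma set_code_vertices (A : {set 'I_n}) v : set_code (@vertex_code n) A v ->
  exists l : seq 'I_n, [/\ uniq l, l =i A & v = tlist (map (@vtree n) l)].
Proof. by move=> [l [ul lA /seq_code_inv Ev]]; exists l; split=> //; apply: Ev. Qed.

Lemma biset_code_ctree (X : biset 'I_n) v : biset_code X v ->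
  exists C, [/\ v = ctree C, uniq2 C & biset_of C = X].
Proof.
case: X => X1 X2 [a [b [/set_code_vertices[l1 [u1 E1 ->]]]]].
move=> /set_code_vertices[l2 [u2 E2 ->]] ->.
exists (l1, l2); split=> //; first by rewrite /uniq2 u1.
by congr pair; apply/setP => x; rewrite inE ?E1 ?E2.
Qed.

Lemma set_code_wtree (c : 'I_n * 'I_n -> rat) (A : {set 'I_n * 'I_n}) v :
  set_code (weighted_edge_code c) A v ->
  exists l, [/\ uniq l, l =i A & v = tlist [seq wtree (e, c e) | e <- l]].
Proof.
move=> [l [ul lA Ev]]; exists l; split=> //.
by apply: seq_code_inv Ev => e u [a [b1 [b2 [-> -> ->]]] ->].
Qed.

End InstanceCodes.

(** Variable 6 holds the chosen core, variable 7 the edge of least reduced cost covering it, paired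
    with that cost. *)
Definition primal_dual_step (Q : prog) : prog :=
  PSeq (PAssign 6 (EHead (EVar 5)))
  (PSeq (PCall 7 pmin (ECons (EVar 6) (EVar 2)))
  (PSeq (PCall 2 preduce (ECons (ECons (EVar 6) (ETail (EVar 7))) (EVar 2)))
  (PSeq (PAssign 3 (ECons (EHead (EVar 7)) (EVar 3)))
  (PSeq (PAssign 4 (ECons (ECons (EVar 6) (EHead (EVar 7))) (EVar 4)))
  (PCall 5 Q (ECons (EVar 1) (EVar 3))))))).

(* Variables: 1 = the input, 2 = the edges with their reduced costs, 3 = the
   edges bought, 4 = the stack of purchases, 5 = the current cores. *)
Definition primal_dual (Q : prog) : prog :=
  PSeq (PAssign 1 (EVar 0))
  (PSeq (PAssign 2 (EHead (ETail (ETail (EVar 0)))))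
  (PSeq (PCall 5 Q (ECons (EVar 1) (EVar 3)))
  (PSeq (PWhile (EVar 5) (primal_dual_step Q))
  (PCall 0 pselect (ECons ENil (EVar 4)))))).

(** Bounds a query: an input of size [N] and at most [N] edges, each of size at most [2 * N + 1]
    plus a list cell. *)
Definition oracle_size N := N + N * (2 * N + 2) + 2.
Definition step_time T N := 2 * min_time N (3 * N + 2) N + T + 60.
Definition primal_dual_time T N :=
  T + (N * (1 + step_time T N).+1 + 2) + select_time N N + 60.

(** * Correctness and running time of the program *)

Section Correctness.
Variables (n : nat) (F : {set biset 'I_n}) (E : {set 'I_n * 'I_n}).
Variable c : 'I_n * 'I_n -> rat.
Hypothesis c_ge0 : forall e, e \in E -> (0 <= c e)%R.
Hypothesis F_coverable : forall X, X \in F -> exists2 e, e \in E & covers e X.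
Variables (Q : prog) (v : tree) (N T : nat).
Hypothesis n_le_N : n.+1 <= N.
Hypothesis E_le_N : #|E| <= N.
Hypothesis bits_le_N : \sum_(e in E) bits (c e) <= N.
Hypothesis v_size : tsize v = N.
Hypothesis oracle : forall (J : {set 'I_n * 'I_n}) w, J \subset E ->
  set_code (@edge_code n) J w -> tsize (TCons v w) <= oracle_size N ->
  exists2 u, runs Q (TCons v w) u T &
    set_code (@biset_code n) (cores (residual F J)) u.

Implicit Types s : seq (purchase n).

Definition jtree s := tlist (map (@etree n) (edges s)).

Lemma jtree_size s : history F E c s -> tsize (TCons v (jtree s)) <= oracle_size N.
Proof.
move=> hs; have sN := leq_trans (history_size hs) E_le_N.
rewrite /= v_size /jtree tlist_size !size_map /oracle_size.
have : \sum_(u <- map (@etree n) (edges s)) tsize u <= size s * (2 * N + 1).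
  rewrite big_map -(size_map (fun p => p.1.2)) -/(edges s) mulnC -sum1_size big_distrr /=.
  apply: leq_sum => e _ /=.
  have := bits_vtree n_le_N e.1; have := bits_vtree n_le_N e.2.
  by move: (bits _) (bits _) => x y; lia.
have := leq_mul sN (leqnn (2 * N + 2)).
by move: (\sum_(_ <- _) _) => z; nia.
Qed.

Lemma oracle_history s : history F E c s ->
  exists2 u, runs Q (TCons v (jtree s)) u T &
    set_code (@biset_code n) (cores (residual F (bought s))) u.
Proof.
move=> hs; apply: oracle; last exact: jtree_size.
  by apply/subsetP => e; rewrite inE; apply: edges_sub hs _.
exact/set_code_edges/(edges_uniq hs).
Qed.

Definition costs s (l : seq ('I_n * 'I_n)) := [seq (e, reduced_cost c s e) | e <- l].

(** [k] counts the edges not yet bought. Any listing [l] of [E] is allowed, because each pass of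
    [preduce] reverses it, and variable 5 may list the cores in any order. *)
Definition loop_inv (k : nat) (st : store) : Prop := exists s (l : seq ('I_n * 'I_n)),
  [/\ history F E c s, k = #|E| - size s, uniq l, l =i E &
  [/\ st 1 = v, st 2 = tlist (map (@wtree n) (costs s l)), st 3 = jtree s,
      st 4 = tlist (map (@ptree n) (map fst s)) &
      set_code (@biset_code n) (cores (residual F (bought s))) (st 5)]].

(** Every member of [F] is covered by some edge of [E], so the minimum search cannot come back
    empty. *)
Lemma purchase_ex s l (C : seq 'I_n * seq 'I_n) : history F E c s -> l =i E ->
  uniq2 C -> biset_of C \in cores (residual F (bought s)) ->
  exists e, foldl (choose_min C) None (costs s l) = Some (e, reduced_cost c s e) /\
    history F E c ((C, e, reduced_cost c s e) :: s).
Proof.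
move=> hs lE uC Ccore.
have := choose_minP C (costs s l); case: (foldl _ _ _) => [w|noC].
  move=> [/mapP[e el ->] eC emin]; exists e; split=> //=.
  split=> //; first by rewrite -lE.
  split=> // e' e'E e'C; apply: (emin (e', reduced_cost c s e')) => //.
  by apply/mapP; exists e'; rewrite ?lE.
have /F_coverable[e eE] : biset_of C \in F.
  by move: Ccore; rewrite inE => /andP[/residualP[]].
rewrite covers_biset_of => eC.
have el : (e, reduced_cost c s e) \in costs s l by apply/mapP; exists e; rewrite ?lE.
by have := noC _ el; rewrite /= eC.
Qed.

Lemma costs_reduce s l C e y :
  reduce_all C y (costs s l) = costs ((C, e, y) :: s) (rev l).
Proof.
rewrite reduce_allE /costs -map_comp map_rev; congr rev; apply: eq_map => e' /=.
by rewrite /reduce reduced_cost_cons /=; case: ifP.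
Qed.

Lemma costs_bits s l (w : ('I_n * 'I_n) * rat) : history F E c s -> l =i E ->
  w \in costs s l -> bits w.2 <= 3 * N + 2.
Proof.
by move=> hs lE /mapP[e el ->]; apply: (reduced_cost_bits c_ge0 hs); rewrite // -lE.
Qed.

Lemma min_time_mono B k : k <= N -> min_time N B k <= min_time N B N.
Proof. exact: fold_time_mono. Qed.

Lemma primal_dual_step_ends k st : loop_inv k st -> truth (st 5) ->
  0 < k /\ ends (primal_dual_step Q) st (step_time T N) (loop_inv k.-1).
Proof.
move=> [s [l [hs kE ul lE [st1 st2 st3 st4 [L [uL LE]]]]]].
case: L uL LE => [|X L] uL LE; first by case: (st 5).
case st5 : (st 5) => [|r|h t] //= [/biset_code_ctree[C [hE uC CX]] _] _.
rewrite {}hE in st5.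
have Ccore : biset_of C \in cores (residual F (bought s)).
  by rewrite CX -LE mem_head.
have [e [eE hs']] := purchase_ex hs lE uC Ccore.
set y := reduced_cost c s e in eE hs'; set s' := _ :: s in hs'.
have sizeN : size (costs s l) <= N.
  by rewrite size_map -(card_uniqP ul) (eq_card lE).
(* The extended history still has at most [#|E|] purchases, so an iteration was left. *)
have size_s := history_size hs'.
split; first by rewrite kE subn_gt0.
have [u Qu cu] := oracle_history hs'.
have bitsE := costs_bits hs lE.
have ybits : bits y <= 3 * N + 2.
  apply: (reduced_cost_bits c_ge0 hs) => //.
  by case: hs' => _ _ _ [].
have run_min : runs pmin (TCons (ctree C) (tlist (map (@wtree n) (costs s l))))
    (wtree (e, y)) (min_time N (3 * N + 2) N).
  have := pmin_runs n_le_N uC bitsE; rewrite eE.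
  by apply: runs_weaken; apply: min_time_mono.
have run_reduce : runs preduce
    (TCons (TCons (ctree C) (TNum y)) (tlist (map (@wtree n) (costs s l))))
    (tlist (map (@wtree n) (costs s' (rev l)))) (min_time N (3 * N + 2) N).
  have := preduce_runs n_le_N uC ybits bitsE; rewrite (costs_reduce s l C e).
  by apply: runs_weaken; apply: min_time_mono.
have final : set_code (@biset_code n) (cores (residual F (bought s'))) u ->
  loop_inv k.-1 (upd (upd (upd (upd (upd (upd st 6 (ctree C)) 7 (wtree (e, y)))
    2 (tlist (map (@wtree n) (costs s' (rev l))))) 3 (jtree s'))
    4 (tlist (map (@ptree n) (map fst s')))) 5 u).
  move=> _; exists s', (rev l); rewrite /upd /= st1; split=> //.
  - by rewrite kE subnS.
  - by rewrite rev_uniq.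
  - by move=> x; rewrite mem_rev lE.
move: {final} (final cu); rewrite /step_time.
move: (min_time _ _ _) run_min run_reduce => B run_min run_reduce final.
clear -st1 st2 st3 st4 st5 Qu run_min run_reduce final.
apply: ends_assign_seq; first by rewrite /=; lia.
rewrite /= st5 /=.
apply: ends_call_seq.
- by rewrite /upd /= st2; exact: run_min.
- by rewrite /=; lia.
apply: ends_call_seq.
- by rewrite /upd /= st2; exact: run_reduce.
- by rewrite /=; lia.
apply: ends_assign_seq; first by rewrite /=; lia.
apply: ends_assign_seq; first by rewrite /=; lia.
apply: ends_call.
- by rewrite /upd /= st1 st3; exact: Qu.
- by rewrite /=; lia.
rewrite [eval _ (ECons (EHead (EVar 7)) _)]/= [eval _ (ECons (ECons _ _) _)]/=.
by rewrite /= /upd /= st3 st4.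
Qed.

Lemma primal_dual_runs es l : hd (tl (tl v)) = es ->
  uniq l -> l =i E -> es = tlist [seq wtree (e, c e) | e <- l] ->
  exists s, [/\ history F E c s, residual F (bought s) = set0 &
    runs (primal_dual Q) v (tlist (map (@etree n) (selection s)))
      (primal_dual_time T N)].
Proof.
move=> vE ul lE esE.
have hs0 : history F E c [::] by [].
have [u0 Qu0 cu0] := oracle_history hs0.
suff [st [t [ex tT [s [hs sc Es]]]]] : ends (primal_dual Q) (init_store v) (primal_dual_time T N)
  (fun st => exists s, [/\ history F E c s, residual F (bought s) = set0
    & st 0 = tlist (map (@etree n) (selection s))]).
  by exists s; split=> //; exists st, t.
have kN : #|E| * (1 + step_time T N).+1 + 2 <= N * (1 + step_time T N).+1 + 2.
  by rewrite leq_add2r leq_mul2r E_le_N orbT.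
rewrite /primal_dual_time.
apply: ends_assign_seq => /=; first by clear; lia.
apply: ends_assign_seq => /=; first by clear; lia.
apply: (@ends_call_seq _ _ _ _ _ u0 T) => /=; [exact: Qu0 | by clear; lia |].
apply: (@ends_seq _ _ _ (#|E| * (1 + step_time T N).+1 + 2)).
  by move: kN; clear; move: (_ * _) (_ * _) => x y; lia.
apply: (@ends_weaken _ _ (#|E| * (1 + step_time T N).+1 + 2) _
  (fun st => exists2 s, history F E c s & residual F (bought s) = set0 /\
     st 4 = tlist (map (@ptree n) (map fst s)))) => [//|st [s hs [sc st4]]|].
  apply: (@ends_call _ _ _ _ (tlist (map (@etree n) (selection s))) (select_time N N)).
  - rewrite /= st4.
    have us p : p \in map fst s -> uniq2 p.1.
      by move=> /mapP[p' p's ->]; apply: purchase_uniq2 hs p's.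
    have := pselect_runs n_le_N us; apply: runs_weaken; rewrite size_map.
    have sN := leq_trans (history_size hs) E_le_N.
    apply: (@leq_trans (fold_time (has_time N (size s) + 40) N)); first exact: fold_time_mono.
    rewrite /select_time /fold_time leq_add2r leq_mul2r; apply/orP; right.
    rewrite 2!leq_add2r; exact: fold_time_mono.
  - by move: kN; clear; rewrite /=; move: (_ * _) (_ * _) (select_time _ _) => x y z; lia.
  - by exists s.
apply: (@ends_while _ _ loop_inv (step_time T N) 1 _ #|E|) => [//|||].
(* At exit the list of cores is empty, and a family without cores is empty. *)
- move=> st k [s [l' [hs _ _ _ [_ _ _ st4 [L [uL LE]]]]]] /= Lcode nt.
  exists s => //; split=> //; apply: cores_eq0; apply/setP => X; rewrite in_set0 -LE.
  by case: L Lcode {uL LE} => [|Y L]; case: (st 5) nt.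
- by move=> st k; apply: primal_dual_step_ends.
exists [::], l; rewrite /upd /= subn0; split=> //; split=> //.
rewrite vE esE /costs -map_comp; congr tlist; apply: eq_map => e /=.
by rewrite /reduced_cost big_nil subr0.
Qed.

End Correctness.

(** * Polynomial time bounds *)

Definition polynomial (f : nat -> nat) : Prop :=
  exists b : {poly nat}, forall N, b.[N]%R = f N.

Lemma polynomial_const k : polynomial (fun=> k).
Proof. by exists k%:P%R => N; rewrite hornerC. Qed.

Lemma polynomial_id : polynomial id.
Proof. by exists 'X%R => N; rewrite hornerX. Qed.

Lemma polynomialD f g : polynomial f -> polynomial g ->
  polynomial (fun N => f N + g N).
Proof. by move=> [a Ha] [b Hb]; exists (a + b)%R => N; rewrite hornerD Ha Hb. Qed.

Lemma polynomialM f g : polynomial f -> polynomial g ->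
  polynomial (fun N => f N * g N).
Proof. by move=> [a Ha] [b Hb]; exists (a * b)%R => N; rewrite hornerM Ha Hb. Qed.

Lemma polynomialS f : polynomial f -> polynomial (fun N => (f N).+1).
Proof.
move=> [a Ha]; exists (a + 1%:P)%R => N.
by rewrite hornerD hornerC Ha -addn1.
Qed.

Lemma polynomial_comp (b : {poly nat}) f : polynomial f ->
  polynomial (fun N => b.[f N]%R).
Proof. by move=> [a Ha]; exists (b \Po a)%R => N; rewrite horner_comp Ha. Qed.

(** Natural coefficients make the polynomial monotone; this passes from the actual size of a query
    to its bound [oracle_size]. *)
Lemma horner_leq (b : {poly nat}) m k : m <= k -> (b.[m]%R <= b.[k]%R)%N.
Proof.
move=> mk; rewrite !horner_coef; elim/big_ind2: _ => // [x1 x2 y1 y2|i _].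
  exact: leq_add.
rewrite leq_mul2l; apply/orP; right.
have E x j : (x ^+ j)%R = (x ^ j)%N by elim: j => // j IH; rewrite exprS IH expnS.
by rewrite !E; have [i0|i0] := posnP i; [rewrite i0 | rewrite leq_exp2r].
Qed.

Lemma primal_dual_time_polynomial (b : {poly nat}) :
  polynomial (fun N => primal_dual_time b.[oracle_size N]%R N).
Proof.
rewrite /primal_dual_time /step_time /select_time /min_time /has_time /covers_time.
rewrite /mem_time /fold_time /oracle_size.
by repeat first [exact: polynomial_id | exact: polynomial_const
  | apply: polynomial_comp | apply: polynomialS | apply: polynomialD | apply: polynomialM].
Qed.

(** The program and its bound are built from those computing the cores alone, uniformly over the
    class [K] of instances. *)
Theorem theorem2 (R : realType) (K : instance -> Prop)
    (semi_intersectingK : forall i, K i ->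
       semi_intersecting (inst_q i) (inst_family i))
    (cost_ge0K : forall i, K i ->
       forall e, e \in inst_edges i -> (0 <= inst_cost i e)%R)
    (coresK : exists (Q : prog) (b : {poly nat}),
       forall i, K i ->
       forall v, instance_code i v ->
       forall J : {set 'I_(inst_n i) * 'I_(inst_n i)}, J \subset inst_edges i ->
       forall w, set_code (@edge_code (inst_n i)) J w ->
       computes_within Q b (TCons v w)
         (set_code (@biset_code (inst_n i)) (cores (residual (inst_family i) J)))) :
  exists (P : prog) (b : {poly nat}),
    forall i, K i ->
    forall v, instance_code i v ->
    forall tau : R, is_tau (inst_family i) (inst_edges i) (inst_cost i) tau ->
    computes_within P b v (fun w =>
      exists J : {set 'I_(inst_n i) * 'I_(inst_n i)},
        [/\ set_code (@edge_code (inst_n i)) J w,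
            J \subset inst_edges i,
            nu (residual (inst_family i) J) <= inst_n i %/ (inst_q i).+1
          & (ratr (\sum_(e in J) inst_cost i e) <= tau)%R]).
Proof.
case: coresK => Q [bQ HQ]; have [b Hb] := primal_dual_time_polynomial bQ.
exists (primal_dual Q), b => i Ki v vcode tau tauP.
have oracle := HQ i Ki v vcode; have Fsemi := semi_intersectingK i Ki.
have c_ge0 := cost_ge0K i Ki.
have [vs [es [/set_code_vertices[lv [ulv lvE Evs]] /set_code_wtree[l [ul lE Ees]] Ev]]] := vcode.
have size_es : tsize es = (\sum_(e in inst_edges i) tsize (wtree (e, inst_cost i e))
    + #|inst_edges i|).+1.
  rewrite Ees tlist_size big_map size_map -(card_uniqP ul) (eq_card lE).
  by rewrite big_uniq //; congr (_ + _).+1; apply: eq_bigl.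
have size_v : tsize vs + tsize es <= tsize v by rewrite Ev /=; lia.
have n_le : (inst_n i).+1 <= tsize v.
  apply: leq_trans size_v; rewrite Evs tlist_size size_map -(card_uniqP ulv).
  by rewrite (eq_card lvE) cardsT card_ord; lia.
have E_le : #|inst_edges i| <= tsize v by lia.
have bits_le : \sum_(e in inst_edges i) bits (inst_cost i e) <= tsize v.
  have : \sum_(e in inst_edges i) bits (inst_cost i e) <=
    \sum_(e in inst_edges i) tsize (wtree (e, inst_cost i e)).
    by apply: leq_sum => e _ /=; lia.
  by lia.
(* The minimum [tau] is attained, so the LP is feasible; a member covered by no edge would require
   an empty sum to be at least 1. *)
have coverable X : X \in inst_family i -> exists2 e, e \in inst_edges i & covers e X.
  case: tauP => -[x [_ xF] _] _ XF.
  have [D0|/set0Pn[e]] := eqVneq (delta (inst_edges i) X) set0.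
    by have := xF X XF; rewrite D0 big_set0 ler10.
  by rewrite inE => /andP[eE eX]; exists e.
have runQ (J : {set 'I_(inst_n i) * 'I_(inst_n i)}) w : J \subset inst_edges i ->
    set_code (@edge_code (inst_n i)) J w ->
    tsize (TCons v w) <= oracle_size (tsize v) ->
    exists2 u, runs Q (TCons v w) u bQ.[oracle_size (tsize v)]%R &
      set_code (@biset_code (inst_n i)) (cores (residual (inst_family i) J)) u.
  move=> JE wJ wsize; have [s [t [ex tT good]]] := oracle J JE w wJ.
  exists (s 0) => //; exists s, t; split=> //.
  exact: leq_trans tT (horner_leq _ wsize).
have esE : hd (tl (tl v)) = es by rewrite Ev.
have [s [hs complete [st [t [ex tT st0]]]]] :=
  primal_dual_runs c_ge0 coverable n_le E_le bits_le erefl runQ esE ul lE Ees.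
exists st, t; split=> //; first by rewrite Hb.
exists [set e in selection s]; rewrite st0.
have [JE nuJ costJ] := selectionP Fsemi c_ge0 hs complete tauP.
by split=> //; apply: set_code_edges; apply: selection_uniq hs.
Qed.
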